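(* Let $V$ be a conformal logarithmic vertex algebra with braiding map $\mathcal S$, in which the locally nilpotent part of the Virasoro operator $L_0$ has the form $$L_0^{(n)}=d+\sum_{i=1}^Lf_ig_i$$ for some $d,f_i,g_i\in\mathrm{Der}(V)$ with $p(f_i)=p(g_i)$ and $p(d)=\bar0$. Then for all $a,b\in V$ we have $$\mathcal S(a\otimes b)=-\sum_{i=1}^L\Bigl(f_i\otimes g_i+(-1)^{p(f_i)}g_i\otimes f_i\Bigr)(a\otimes b)\mod\operatorname{Ker}Y(z).$$
   Context: Conventions. All superspaces, tensor products and Hom's are over $\mathbb C$; $p(v)$ is the parity; formulas with $p$ are for homogeneous elements, extended linearly. $(\phi\otimes\psi)(a\otimes b)=(-1)^{p(\psi)p(a)}\phi(a)\otimes\psi(b)$; $[\cdot,\cdot]$ is the supercommutator; $P(a\otimes b)=(-1)^{p(a)p(b)}b\otimes a$; $I$ is the identity. $z,z_1,z_2$, $\zeta,\zeta_1,\zeta_2$ are commuting even formal variables ($\zeta_i$ plays the role of $\log z_i$). $D_z=\partial_z+z^{-1}\partial_\zeta$, $z_{12}=z_1-z_2$, $\vartheta_{12}=\zeta_1-\sum_{n\ge1}\frac1n z_1^{-n}z_2^n$, $\vartheta_{21}=\zeta_2-\sum_{n\ge1}\frac1n z_1^{n}z_2^{-n}$. $\mathrm{LF}(V)=\mathrm{Hom}(V,V(\!(z)\!)[\zeta])$ with its natural superspace structure. Braiding map. A braiding map on $V$ is an even element $\mathcal S\in\mathrm{End}(V)\otimes\mathrm{End}(V)$ with $\mathcal SP=P\mathcal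 S$ and $[\mathcal S_{12},\mathcal S_{23}]=[\mathcal S_{13},\mathcal S_{23}]=[\mathcal S_{12},\mathcal S_{13}]=0$ on $V^{\otimes3}$, where $\mathcal S_{12}=\mathcal S\otimes I$, $\mathcal S_{23}=I\otimes\mathcal S$, $\mathcal S_{13}=(I\otimes P)\mathcal S_{12}(I\otimes P)$. Logarithmic vertex algebra (logVA) $(V,\boldsymbol1,T,Y,\mathcal S)$: a superspace $V$, an even vector $\boldsymbol1$, an even $T\in\mathrm{End}(V)$, an even linear map $Y:V\to\mathrm{LF}(V)$, $a\mapsto Y(a,z)$, and a braiding map $\mathcal S$ on $V$ such that, with $Y(z)(a\otimes b):=Y(a,z)b$: (vacuum) $Y(\boldsymbol1,z)=I$, $Y(a,z)\boldsymbol1\in V[\![z]\!]$, $Y(a,z)\boldsymbol1|_{z=0}=a$, $T\boldsymbol1=0$; (covariance) $[T,Y(a,z)]=D_zY(a,z)$; (nilpotence) $\mathcal S$ is locally nilpotent on $V\otimes V$; (locality) for all $a,b\in V$ there is $N\in\mathbb Z_+$ such that for all $c\in V$, $Y(z_1)(I\otimes Y(z_2))z_{12}^Ne^{\vartheta_{12}\mathcal S_{12}}(a\otimes b\otimes c)=(-1)^{p(a)p(b)}Y(z_2)(I\otimes Y(z_1))z_{12}^Ne^{\vartheta_{21}\mathcal S_{12}}(b\otimes a\otimes c)$; (hexagon) $\mathcal S(Y(z)\otimes I)=(Y(z)\otimes I)(\mathcal S_{13}+\mathcal S_{23})$ on $V^{\otimes3}$. Modes $a_{(n+\mathcal S)}\in\mathrm{End}(V)$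 are defined by $Y(a,z)|_{\zeta=0}=\sum_na_{(n+\mathcal S)}z^{-n-1}$. $\operatorname{Ker}Y(z)$ is the kernel of the linear map $Y(z):V\otimes V\to V(\!(z)\!)[\zeta]$. Derivations. $D\in\mathrm{Der}(V)$ means $D\in\mathrm{End}(V)$ with $D(Y(a,z)b)=Y(Da,z)b+(-1)^{p(a)p(D)}Y(a,z)Db$ for all $a,b\in V$. Conformal. A logVA is conformal of central charge $c\in\mathbb C$ if there is an even vector $\omega\in V$ with: $\mathcal S(\omega\otimes v)=0$ for all $v\in V$; the modes $L_n:=\omega_{(n+1+\mathcal S)}$ satisfy the Virasoro relations with central charge $c$; $L_{-1}=T$; $L_0$ is locally finite on $V$ (every vector lies in a finite-dimensional $L_0$-invariant subspace). $L_0=L_0^{(s)}+L_0^{(n)}$ is the Jordan–Chevalley decomposition: $[L_0^{(s)},L_0^{(n)}]=0$, $L_0^{(s)}$ semisimple, $L_0^{(n)}$ locally nilpotent. *)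

(* Defs.v *)
From HB Require Import structures.
From mathcomp Require Import all_boot all_order all_algebra.
From mathcomp Require Import generic_quotient complex.
From mathcomp Require Import all_classical all_reals.

Set Implicit Arguments.
Unset Strict Implicit.
Unset Printing Implicit Defensive.
Import Order.TTheory GRing.Theory Num.Theory.
Local Open Scope ring_scope.
Local Open Scope classical_set_scope.
Local Open Scope quotient_scope.

(** * Hom spaces *)

Section HomLmodule.
Variables (K : fieldType) (U W : lmodType K).
Implicit Types f g : {linear U -> W}.

Definition mkhom (f : U -> W) (h : linear f) : {linear U -> W} :=
  HB.pack f (GRing.isLinear.Build K U W *:%R f h).

Lemma mkhomE (f : U -> W) (h : linear f) u : mkhom h u = f u.
Proof. by []. Qed.

Lemma homP f g : f =1 g -> f = g.
Proof.
move=> /funext; case: f g => f [[df] [mf]] [g [[dg] [mg]]] /= e; subst g.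
by rewrite (Prop_irrelevance df dg) (Prop_irrelevance mf mg).
Qed.

Let hzero : {linear U -> W} := \0.
Let hopp f : {linear U -> W} := \- f.
Let hadd f g : {linear U -> W} := f \+ g.
Let hscale (a : K) f : {linear U -> W} := a \*: f.

Let haddA : associative hadd.
Proof. by move=> f g h; apply: homP => u; rewrite /= addrA. Qed.
Let haddC : commutative hadd.
Proof. by move=> f g; apply: homP => u; rewrite /= addrC. Qed.
Let hadd0 : left_id hzero hadd.
Proof. by move=> f; apply: homP => u; rewrite /= add0r. Qed.
Let haddN : left_inverse hzero hopp hadd.
Proof. by move=> f; apply: homP => u; rewrite /= addNr. Qed.

HB.instance Definition _ :=
  GRing.isZmodule.Build {linear U -> W} haddA haddC hadd0 haddN.

Let hscaleA a b f : hscale a (hscale b f) = hscale (a * b) f.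
Proof. by apply: homP => u; rewrite /= scalerA. Qed.
Let hscale1 : left_id 1 hscale.
Proof. by move=> f; apply: homP => u; rewrite /= scale1r. Qed.
Let hscaleDr : right_distributive hscale +%R.
Proof. by move=> a f g; apply: homP => u; rewrite /= scalerDr. Qed.
Let hscaleDl f : {morph hscale^~ f : a b / a + b}.
Proof. by move=> a b; apply: homP => u; rewrite /= scalerDl. Qed.

HB.instance Definition _ := GRing.Zmodule_isLmodule.Build K {linear U -> W}
  hscaleA hscale1 hscaleDr hscaleDl.

Lemma hom0E u : (0 : {linear U -> W}) u = 0. Proof. by []. Qed.
Lemma homDE f g u : (f + g) u = f u + g u. Proof. by []. Qed.
Lemma homNE f u : (- f) u = - f u. Proof. by []. Qed.
Lemma homZE a f u : (a *: f) u = a *: f u. Proof. by []. Qed.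
Lemma hom_sumE (I : Type) (r : seq I) (P : pred I) (F : I -> {linear U -> W}) u :
  (\sum_(i <- r | P i) F i) u = \sum_(i <- r | P i) F i u.
Proof. by elim/big_rec2: _ => [//|i x y _ <-]. Qed.

End HomLmodule.

Arguments mkhom : simpl never.

Definition hcomp (K : fieldType) (U W X : lmodType K) (f : {linear W -> X})
  (g : {linear U -> W}) : {linear U -> X} := f \o g.

Section Bilinear.
Variables (K : fieldType) (U W X : lmodType K) (f : U -> W -> X).
Hypotheses (fl : forall w, linear (f^~ w)) (fr : forall u, linear (f u)).

Let mkbilin_linear : linear (fun u => mkhom (fr u) : {linear W -> X}).
Proof. by move=> a u v; apply: homP => w; rewrite /= fl. Qed.

Definition mkbilin : {linear U -> {linear W -> X}} := mkhom mkbilin_linear.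

Lemma mkbilinE u w : mkbilin u w = f u w. Proof. by []. Qed.

End Bilinear.

Arguments mkbilin : simpl never.

Section BilinearTheory.
Variables (K : fieldType) (U W X : lmodType K).
Variable b : {linear U -> {linear W -> X}}.

Lemma bilinP a u v w : b (a *: u + v) w = a *: b u w + b v w.
Proof. by rewrite (linearP b). Qed.
Lemma bilinD u v w : b (u + v) w = b u w + b v w.
Proof. by rewrite (linearD b). Qed.
Lemma bilinZ a u w : b (a *: u) w = a *: b u w.
Proof. by rewrite (linearZ_LR b). Qed.
Lemma bilin0 w : b 0 w = 0.
Proof. by rewrite (linear0 b). Qed.
Lemma bilin_sum (I : Type) (r : seq I) (P : pred I) (F : I -> U) w :
  b (\sum_(i <- r | P i) F i) w = \sum_(i <- r | P i) b (F i) w.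
Proof. by rewrite (linear_sum b) hom_sumE. Qed.

End BilinearTheory.

(** * Tensor products *)

Section TensorDef.
Variables (K : fieldType) (U W : lmodType K).

(* A list of pairs stands for the sum of the corresponding pure tensors. *)
Inductive tensor_eq : seq (U * W) -> seq (U * W) -> Prop :=
| TensorRefl s : tensor_eq s s
| TensorSym s t : tensor_eq s t -> tensor_eq t s
| TensorTrans s t r : tensor_eq s t -> tensor_eq t r -> tensor_eq s r
| TensorCat s s' t t' : tensor_eq s s' -> tensor_eq t t' ->
    tensor_eq (s ++ t) (s' ++ t')
| TensorSwap s t : tensor_eq (s ++ t) (t ++ s)
| Tensor0 w : tensor_eq [:: (0, w)] [::]
| TensorDl u u' w : tensor_eq [:: (u + u', w)] [:: (u, w); (u', w)]
| TensorDr u w w' : tensor_eq [:: (u, w + w')] [:: (u, w); (u, w')]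
| TensorZ a u w : tensor_eq [:: (a *: u, w)] [:: (u, a *: w)].

Definition tensor_eqb (s t : seq (U * W)) : bool := `[< tensor_eq s t >].

Lemma tensor_eqb_refl : reflexive tensor_eqb.
Proof. by move=> s; apply/asboolP; exact: TensorRefl. Qed.
Lemma tensor_eqb_sym : symmetric tensor_eqb.
Proof. by move=> s t; apply/asboolP/asboolP; exact: TensorSym. Qed.
Lemma tensor_eqb_trans : transitive tensor_eqb.
Proof.
by move=> s t r /asboolP h1 /asboolP h2; apply/asboolP; apply: TensorTrans h1 h2.
Qed.

Canonical tensor_equiv :=
  EquivRel tensor_eqb tensor_eqb_refl tensor_eqb_sym tensor_eqb_trans.

Definition tensor := {eq_quot tensor_equiv}.
HB.instance Definition _ := Choice.on tensor.
HB.instance Definition _ := EqQuotient.on tensor.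

Definition tclass (s : seq (U * W)) : tensor := \pi_tensor s.

Lemma tclassP s t : tclass s = tclass t <-> tensor_eq s t.
Proof.
split=> [/eqP|h]; first by rewrite eqmodE => /asboolP.
by apply/eqP; rewrite eqmodE; apply/asboolP.
Qed.

Lemma tclass_repr (x : tensor) : tclass (repr x) = x.
Proof. exact: reprK. Qed.

Lemma repr_tclass s : tensor_eq (repr (tclass s)) s.
Proof. by apply/tclassP; rewrite tclass_repr. Qed.

Let zscale (a : K) (s : seq (U * W)) := [seq (a *: p.1, p.2) | p <- s].

Let zscale_eq a s t : tensor_eq s t -> tensor_eq (zscale a s) (zscale a t).
Proof.
elim=> {s t} [s|s t _|s t r _ h1 _ h2|s s' t t' _ h1 _ h2|s t|w|u u' w|u w w'|b u w].
- exact: TensorRefl.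
- exact: TensorSym.
- exact: TensorTrans h1 h2.
- by rewrite /zscale !map_cat; exact: TensorCat.
- by rewrite /zscale !map_cat; exact: TensorSwap.
- by rewrite /zscale /= scaler0; exact: Tensor0.
- by rewrite /zscale /= scalerDr; exact: TensorDl.
- exact: TensorDr.
- by rewrite /zscale /= scalerA mulrC -scalerA; exact: TensorZ.
Qed.

Let tzero : tensor := tclass [::].
Let tadd (x y : tensor) : tensor := tclass (repr x ++ repr y).
Let tscale a (x : tensor) : tensor := tclass (zscale a (repr x)).
Let topp := tscale (-1).

Let taddE s t : tadd (tclass s) (tclass t) = tclass (s ++ t).
Proof. by apply/tclassP; apply: TensorCat; exact: repr_tclass. Qed.
Let tscaleE a s : tscale a (tclass s) = tclass (zscale a s).
Proof. by apply/tclassP; apply: zscale_eq; exact: repr_tclass. Qed.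

Let taddA : associative tadd.
Proof.
move=> x y z; rewrite -(tclass_repr x) -(tclass_repr y) -(tclass_repr z).
by rewrite !taddE catA.
Qed.
Let taddC : commutative tadd.
Proof.
move=> x y; rewrite -(tclass_repr x) -(tclass_repr y) !taddE.
by apply/tclassP; exact: TensorSwap.
Qed.
Let tadd0 : left_id tzero tadd.
Proof. by move=> x; rewrite -(tclass_repr x) taddE. Qed.

Let tscaleDl x : {morph tscale^~ x : a b / a + b >-> tadd a b}.
Proof.
move=> a b; rewrite -(tclass_repr x) !tscaleE.
elim: (repr x) => [|[u w] s ih] /=; first by rewrite taddE.
rewrite -[_ :: zscale (a + b) s]cat1s -taddE ih.
rewrite -[_ :: zscale a s]cat1s -[_ :: zscale b s]cat1s -!taddE.
have -> : tclass [:: ((a + b) *: u, w)]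
   = tadd (tclass [:: (a *: u, w)]) (tclass [:: (b *: u, w)]).
  by rewrite taddE scalerDl; apply/tclassP; exact: TensorDl.
by rewrite -!taddA; congr (tadd _ _); rewrite taddA [X in tadd X _]taddC -taddA.
Qed.
Let tscale0 x : tscale 0 x = tzero.
Proof.
rewrite -(tclass_repr x) tscaleE; elim: (repr x) => [//|[u w] s ih] /=.
rewrite -[_ :: zscale 0 s]cat1s -taddE ih scale0r.
have -> : tclass [:: (0, w)] = tzero by apply/tclassP; exact: Tensor0.
exact: tadd0.
Qed.
Let tscale1 : left_id 1 tscale.
Proof.
move=> x; rewrite -[RHS]tclass_repr -{1}(tclass_repr x) tscaleE.
congr tclass; rewrite -[RHS]map_id; apply: eq_map => -[u w] /=.
by rewrite scale1r.
Qed.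
Let taddN : left_inverse tzero topp tadd.
Proof.
by move=> x; rewrite -{2}(tscale1 x) -tscaleDl addNr tscale0.
Qed.

HB.instance Definition _ := GRing.isZmodule.Build tensor taddA taddC tadd0 taddN.

Let tscaleA a b x : tscale a (tscale b x) = tscale (a * b) x.
Proof.
rewrite -(tclass_repr x) !tscaleE; congr tclass; rewrite /zscale -map_comp.
by apply: eq_map => -[u w] /=; rewrite scalerA.
Qed.
Let tscaleDr : right_distributive tscale +%R.
Proof.
move=> a x y; rewrite -(tclass_repr x) -(tclass_repr y) !tscaleE.
have DE s t : tclass s + tclass t = tclass (s ++ t) by rewrite -taddE.
rewrite DE; apply/tclassP; rewrite /zscale map_cat.
by apply: TensorCat; apply: zscale_eq; exact: repr_tclass.
Qed.

HB.instance Definition _ := GRing.Zmodule_isLmodule.Build K tensor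
  tscaleA tscale1 tscaleDr tscaleDl.

Lemma tclass_cat s t : tclass (s ++ t) = tclass s + tclass t.
Proof. by rewrite -taddE. Qed.
Lemma tclass_nil : tclass [::] = 0. Proof. by []. Qed.

Let pure (u : U) (w : W) : tensor := tclass [:: (u, w)].
Let pureZ a u w : a *: pure u w = pure (a *: u) w.
Proof. by rewrite -[LHS]/(tscale a (pure u w)) tscaleE. Qed.
Let pure_l w : linear (pure^~ w).
Proof.
move=> a u v; rewrite pureZ -tclass_cat; apply/tclassP; exact: TensorDl.
Qed.
Let pure_r u : linear (pure u).
Proof.
move=> a v w; rewrite pureZ.
have -> : pure (a *: u) v = pure u (a *: v) by apply/tclassP; exact: TensorZ.
by rewrite -tclass_cat; apply/tclassP; exact: TensorDr.
Qed.

Fact tpure_key : unit. Proof. by []. Qed.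
(* The universal bilinear map, locked to prevent unfolding in simplification. *)
Definition tpure : {linear U -> {linear W -> tensor}} :=
  locked_with tpure_key (mkbilin pure_l pure_r).

Lemma tpureE u w : tpure u w = tclass [:: (u, w)].
Proof. by rewrite /tpure locked_withE. Qed.

Lemma tclass_sum s : tclass s = \sum_(p <- s) tpure p.1 p.2.
Proof.
elim: s => [|[u w] s ih]; first by rewrite big_nil.
by rewrite -cat1s tclass_cat ih big_cat big_seq1 tpureE.
Qed.

End TensorDef.

Notation "U '\tensor' W" := (tensor U W) (at level 40, left associativity)
  : type_scope.
Notation "u '\ox' w" := (tpure _ _ u w) (at level 40, left associativity)
  : ring_scope.

Section TensorLift.
Variables (K : fieldType) (U W X : lmodType K).

Lemma tensor_ext (f g : {linear U \tensor W -> X}) :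
  (forall u w, f (u \ox w) = g (u \ox w)) -> f = g.
Proof.
move=> h; apply: homP => x; rewrite -(tclass_repr x) tclass_sum !linear_sum.
by apply: eq_bigr => p _; exact: h.
Qed.

Variable b : {linear U -> {linear W -> X}}.

Let lift_seq (s : seq (U * W)) : X := \sum_(p <- s) b p.1 p.2.

Let lift_seq_eq s t : tensor_eq s t -> lift_seq s = lift_seq t.
Proof.
rewrite /lift_seq.
elim=> {s t} [s|s t _|s t r _ -> _ //|s s' t t' _ h1 _ h2|s t|w|u u' w|u w w'|a u w].
- by [].
- by [].
- by rewrite !big_cat /= h1 h2.
- by rewrite !big_cat /= addrC.
- by rewrite big_seq1 big_nil /= linear0.
- by rewrite big_seq1 big_cons big_seq1 /= linearD.
- by rewrite big_seq1 big_cons big_seq1 /= linearD.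
- by rewrite !big_seq1 /= !linearZ.
Qed.

Let lift (x : U \tensor W) : X := lift_seq (repr x).

Let liftE s : lift (tclass s) = lift_seq s.
Proof. by apply: lift_seq_eq; exact: repr_tclass. Qed.

Let lift_linear : linear lift.
Proof.
move=> a x y; rewrite -(tclass_repr x) -(tclass_repr y).
have -> : a *: tclass (repr x) = tclass [seq (a *: p.1, p.2) | p <- repr x].
  rewrite !tclass_sum scaler_sumr big_map; apply: eq_bigr => p _.
  by rewrite bilinZ.
rewrite -tclass_cat !liftE /lift_seq big_cat big_map scaler_sumr /=.
by congr (_ + _); apply: eq_bigr => p _; rewrite linearZ.
Qed.

Fact tlift_key : unit. Proof. by []. Qed.
(* The linear map induced by the bilinear map b. *)
Definition tlift : {linear U \tensor W -> X} :=
  locked_with tlift_key (mkhom lift_linear).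

Lemma tliftE u w : tlift (u \ox w) = b u w.
Proof.
by rewrite /tlift locked_withE mkhomE tpureE liftE /lift_seq big_seq1.
Qed.

End TensorLift.

Section TensorAssoc.
Variables (K : fieldType) (U W X : lmodType K).

Let assoc_in (x : X) (u : U) (w : W) : U \tensor (W \tensor X) :=
  u \ox (w \ox x).
Let assoc_l x w : linear ((assoc_in x)^~ w).
Proof. by move=> a u v; rewrite /assoc_in bilinP. Qed.
Let assoc_r x u : linear (assoc_in x u).
Proof. by move=> a v w; rewrite /assoc_in bilinP linearP. Qed.
Let assoc_x (y : U \tensor W) (x : X) :=
  tlift (mkbilin (assoc_l x) (assoc_r x)) y.
Let assoc_xl x : linear (assoc_x^~ x).
Proof. by move=> a y y'; rewrite /assoc_x linearP. Qed.
Let assoc_xr y : linear (assoc_x y).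
Proof.
move=> a x x'; rewrite /assoc_x -homZE -homDE; set f := tlift _; set g := (_ + _).
suff -> : f = g by []; rewrite {}/f {}/g; apply: tensor_ext => u w; rewrite homDE homZE !tliftE !mkbilinE /assoc_in.
by rewrite (linearP (tpure W X w)) (linearP (tpure _ _ u)).
Qed.

Definition tassoc : {linear (U \tensor W) \tensor X -> U \tensor (W \tensor X)} :=
  tlift (mkbilin assoc_xl assoc_xr).

Lemma tassocE u w x : tassoc (u \ox w \ox x) = u \ox (w \ox x).
Proof. by rewrite /tassoc tliftE mkbilinE /assoc_x tliftE mkbilinE. Qed.

Let cossa_in (u : U) (w : W) (x : X) : (U \tensor W) \tensor X :=
  (u \ox w) \ox x.
Let cossa_l u x : linear ((cossa_in u)^~ x).
Proof. by move=> a w v; rewrite /cossa_in linearP bilinP. Qed.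
Let cossa_r u w : linear (cossa_in u w).
Proof. by move=> a v x; rewrite /cossa_in linearP. Qed.
Let cossa_x (u : U) (y : W \tensor X) :=
  tlift (mkbilin (cossa_l u) (cossa_r u)) y.
Let cossa_xr u : linear (cossa_x u).
Proof. by move=> a y y'; rewrite /cossa_x linearP. Qed.
Let cossa_xl y : linear (cossa_x^~ y).
Proof.
move=> a u u'; rewrite /cossa_x -homZE -homDE; set f := tlift _; set g := (_ + _).
suff -> : f = g by []; rewrite {}/f {}/g; apply: tensor_ext => w x; rewrite homDE homZE !tliftE !mkbilinE /cossa_in.
by rewrite !bilinP.
Qed.

Definition tcossa : {linear U \tensor (W \tensor X) -> (U \tensor W) \tensor X} :=
  tlift (mkbilin cossa_xl cossa_xr).

Lemma tcossaE u w x : tcossa (u \ox (w \ox x)) = u \ox w \ox x.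
Proof. by rewrite /tcossa tliftE mkbilinE /cossa_x tliftE mkbilinE. Qed.

End TensorAssoc.

Arguments tassoc {K U W X}.
Arguments tcossa {K U W X}.

(** * Superspaces *)

(* [par p] is the projection onto the component of parity [p] ([true] is odd);
   the two components are the ranges of complementary projections. *)
HB.mixin Record isSuper (K : fieldType) V of GRing.Lmodule K V := {
  par : bool -> {linear V -> V};
  parK : forall p q v, par p (par q v) = if p == q then par q v else 0;
  par_sum : forall v, par false v + par true v = v }.

#[short(type="superType")]
HB.structure Definition Super (K : fieldType) :=
  { V of GRing.Lmodule K V & isSuper K V }.

Definition homog (K : fieldType) (V : superType K) (p : bool) (v : V) : Prop :=
  par p v = v.

Definition ksign (K : fieldType) (p q : bool) : K := (-1) ^+ (p && q).
Arguments ksign {K} p q.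

Lemma par_bigsum (K : fieldType) (V : superType K) (v : V) :
  \sum_p par p v = v.
Proof. by rewrite big_bool /= addrC par_sum. Qed.

Section HomSuper.
Variables (K : fieldType) (U W : superType K).

Let hpar_fun (p : bool) (f : {linear U -> W}) : {linear U -> W} :=
  \sum_q hcomp (par (p (+) q)) (hcomp f (par q)).

Let hpar_linear p : linear (hpar_fun p).
Proof.
move=> a f g; apply: homP => u.
rewrite homDE homZE !hom_sumE scaler_sumr -big_split /=.
by apply: eq_bigr => q _; rewrite linearP.
Qed.

Fact hom_par_key : unit. Proof. by []. Qed.
Let hpar p : {linear {linear U -> W} -> {linear U -> W}} :=
  locked_with hom_par_key (mkhom (hpar_linear p)).

Let hparE p f u : hpar p f u = \sum_q par (p (+) q) (f (par q u)).
Proof. by rewrite /hpar locked_withE mkhomE /hpar_fun hom_sumE. Qed.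

Let hparK p q f : hpar p (hpar q f) = if p == q then hpar q f else 0.
Proof.
apply: homP => u; rewrite hparE !big_bool /= !hparE !big_bool /= !parK /=.
case: p; case: q => /=; rewrite ?hparE ?big_bool /= ?linear0 ?add0r ?addr0 ?parK //=;
  by rewrite ?linear0 ?add0r ?addr0.
Qed.

Let hpar_sum f : hpar false f + hpar true f = f.
Proof.
apply: homP => u; rewrite homDE !hparE !big_bool /=.
rewrite addrACA [par true _ + par false _]addrC !par_sum -linearD.
by rewrite addrC par_sum.
Qed.

HB.instance Definition _ := isSuper.Build K {linear U -> W} hparK hpar_sum.

Lemma par_homE p (f : {linear U -> W}) u :
  par p f u = \sum_q par (p (+) q) (f (par q u)).
Proof. exact: hparE. Qed.

End HomSuper.

Section TensorSuper.
Variables (K : fieldType) (U W : superType K).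

Let tpar_fun (p : bool) (u : U) (w : W) : U \tensor W :=
  \sum_q par q u \ox par (p (+) q) w.
Let tpar_l p w : linear ((tpar_fun p)^~ w).
Proof.
move=> a u v; rewrite /tpar_fun scaler_sumr -big_split /=.
by apply: eq_bigr => q _; rewrite (linearP (par q)) bilinP.
Qed.
Let tpar_r p u : linear (tpar_fun p u).
Proof.
move=> a v w; rewrite /tpar_fun scaler_sumr -big_split /=.
by apply: eq_bigr => q _; rewrite (linearP (par _)) (linearP (tpure U W _)).
Qed.
Let tpar p : {linear U \tensor W -> U \tensor W} :=
  tlift (mkbilin (tpar_l p) (tpar_r p)).
Let tparE p u w : tpar p (u \ox w) = \sum_q par q u \ox par (p (+) q) w.
Proof. by rewrite /tpar tliftE mkbilinE. Qed.

Let tparK p q x : tpar p (tpar q x) = if p == q then tpar q x else 0.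
Proof.
rewrite -[LHS]/(hcomp (tpar p) (tpar q) x).
rewrite -[X in if _ then _ else X](hom0E (U \tensor W) x).
rewrite -[RHS](fun_if (fun f : {linear U \tensor W -> U \tensor W} => f x)).
set f := hcomp _ _; set g := (if _ then _ else _).
suff -> : f = g by []; rewrite {}/f {}/g; apply: tensor_ext => u w.
rewrite -[LHS]/(tpar p (tpar q (u \ox w))) tparE !big_bool linearD /= !tparE.
rewrite !big_bool /= !parK /=.
case: p; case: q => /=; rewrite ?tparE ?big_bool /= ?(linear0 (tpure U W _))
  ?(linear0 (tpure U W)) ?bilin0 ?add0r ?addr0 ?hom0E ?addr0 //=.
Qed.

Let tpar_sum x : tpar false x + tpar true x = x.
Proof.
rewrite -homDE.
suff -> : tpar false + tpar true = mkhom (fun a x y => erefl (a *: x + y)) by [].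
apply: tensor_ext => u w; rewrite homDE !tparE !big_bool mkhomE /=.
rewrite addrACA -!(linearD (tpure U W _)) /=.
rewrite [par true w + _]addrC !par_sum -bilinD.
by rewrite [par true u + _]addrC par_sum.
Qed.

HB.instance Definition _ := isSuper.Build K (U \tensor W) tparK tpar_sum.

Lemma par_tensorE p (u : U) (w : W) :
  par p (u \ox w) = \sum_q par q u \ox par (p (+) q) w.
Proof. exact: tparE. Qed.

End TensorSuper.

Section TensorMap.
Variables (K : fieldType) (U W U' W' : superType K).

Section TensorMapDef.
Variables (f : {linear U -> U'}) (g : {linear W -> W'}).

Let tmap_fun (u : U) (w : W) : U' \tensor W' :=
  \sum_p \sum_q ksign q p *: (f (par p u) \ox par q g w).
Let tmap_l w : linear (tmap_fun^~ w).
Proof.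
move=> a u v; rewrite /tmap_fun scaler_sumr -big_split /=.
apply: eq_bigr => p _; rewrite scaler_sumr -big_split /=.
apply: eq_bigr => q _.
by rewrite (linearP (par p)) (linearP f) bilinP scalerDr !scalerA mulrC.
Qed.
Let tmap_r u : linear (tmap_fun u).
Proof.
move=> a v w; rewrite /tmap_fun scaler_sumr -big_split /=.
apply: eq_bigr => p _; rewrite scaler_sumr -big_split /=.
apply: eq_bigr => q _.
by rewrite (linearP (par q g)) (linearP (tpure U' W' _)) scalerDr !scalerA mulrC.
Qed.

(* f \otimes g, with the sign rule, extended linearly to inhomogeneous g. *)
Definition tmap : {linear U \tensor W -> U' \tensor W'} :=
  tlift (mkbilin tmap_l tmap_r).

Lemma tmapE u w : tmap (u \ox w) =
  \sum_p \sum_q ksign q p *: (f (par p u) \ox par q g w).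
Proof. by rewrite /tmap tliftE mkbilinE. Qed.

Lemma tmap_homogE p q u w : homog p u -> homog q g ->
  tmap (u \ox w) = ksign q p *: (f u \ox g w).
Proof.
move=> hu hg; rewrite tmapE (bigD1 p) //= (bigD1 q) //= hu hg.
rewrite big1 ?addr0 => [|q' /negbTE nq]; last first.
  by rewrite -hg parK nq hom0E (linear0 (tpure U' W' _)) scaler0.
rewrite big1 ?addr0 // => p' /negbTE np.
by rewrite big1 // => q' _; rewrite -hu parK np linear0 bilin0 scaler0.
Qed.

End TensorMapDef.

Let tmap_lin_l g : linear (tmap^~ g).
Proof.
move=> a f f'; apply: tensor_ext => u w.
rewrite homDE homZE !tmapE scaler_sumr -big_split /=.
apply: eq_bigr => p _; rewrite scaler_sumr -big_split /=.
apply: eq_bigr => q _.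
by rewrite bilinP scalerDr !scalerA mulrC.
Qed.
Let tmap_lin_r f : linear (tmap f).
Proof.
move=> a g g'; apply: tensor_ext => u w.
rewrite homDE homZE !tmapE scaler_sumr -big_split /=.
apply: eq_bigr => p _; rewrite scaler_sumr -big_split /=.
apply: eq_bigr => q _.
by rewrite (linearP (par q)) homDE homZE (linearP (tpure U' W' _)) scalerDr !scalerA mulrC.
Qed.

(* The canonical map Hom \otimes Hom -> Hom of the tensor products. *)
Definition tact : {linear {linear U -> U'} \tensor {linear W -> W'} ->
    {linear U \tensor W -> U' \tensor W'}} :=
  tlift (mkbilin tmap_lin_l tmap_lin_r).

Lemma tactE f g : tact (f \ox g) = tmap f g.
Proof. by rewrite /tact tliftE mkbilinE. Qed.

End TensorMap.

Arguments tact {K U W U' W'}.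

Section Flip.
Variables (K : fieldType) (U W : superType K).

Let flip_fun (u : U) (w : W) : W \tensor U :=
  \sum_p \sum_q ksign p q *: (par q w \ox par p u).
Let flip_l w : linear (flip_fun^~ w).
Proof.
move=> a u v; rewrite /flip_fun scaler_sumr -big_split /=.
apply: eq_bigr => p _; rewrite scaler_sumr -big_split /=.
apply: eq_bigr => q _.
by rewrite (linearP (par p)) (linearP (tpure W U _)) scalerDr !scalerA mulrC.
Qed.
Let flip_r u : linear (flip_fun u).
Proof.
move=> a v w; rewrite /flip_fun scaler_sumr -big_split /=.
apply: eq_bigr => p _; rewrite scaler_sumr -big_split /=.
apply: eq_bigr => q _.
by rewrite (linearP (par q)) bilinP scalerDr !scalerA mulrC.
Qed.

Definition flip : {linear U \tensor W -> W \tensor U} :=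
  tlift (mkbilin flip_l flip_r).

Lemma flipE u w :
  flip (u \ox w) = \sum_p \sum_q ksign p q *: (par q w \ox par p u).
Proof. by rewrite /flip tliftE mkbilinE. Qed.

End Flip.

Arguments flip {K U W}.

(** * The space V((z))[zeta] *)

Section LogSeries.
Variable (K : fieldType).

(* [coef f n k] is the coefficient of z^n zeta^k. *)
Record logser (V : lmodType K) := LogSer {
  coef : int -> nat -> V;
  coef_bounded : exists (N : int) (d : nat), forall n k,
    (n < N) || (d <= k)%N -> coef n k = 0 }.

End LogSeries.

Section LogSeriesLmodule.
Variables (K : fieldType) (V : lmodType K).
Implicit Types f g : logser V.

HB.instance Definition _ := gen_eqMixin (logser V).
HB.instance Definition _ := gen_choiceMixin (logser V).

Lemma logserP f g : (forall n k, coef f n k = coef g n k) -> f = g.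
Proof.
case: f g => [f hf] [g hg] /= e.
have efg : f = g by apply/funext => n; apply/funext => k.
by subst g; rewrite (Prop_irrelevance hf hg).
Qed.

Let lzero : logser V.
Proof. by exists (fun _ _ => 0); exists 0, 0%N. Defined.
Let lopp f : logser V.
Proof.
exists (fun n k => - coef f n k); have [N [d h]] := coef_bounded f.
by exists N, d => n k /h ->; rewrite oppr0.
Defined.
Let ladd f g : logser V.
Proof.
exists (fun n k => coef f n k + coef g n k).
have [N [d h]] := coef_bounded f; have [M [e h']] := coef_bounded g.
exists (Num.min N M), (maxn d e) => n k.
rewrite lt_min geq_max => hnk; rewrite h ?h' ?addr0 //.
  by case/orP: hnk => /andP[? ?]; apply/orP; [left|right].
by case/orP: hnk => /andP[? ?]; apply/orP; [left|right].
Defined.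
Let lscale (a : K) f : logser V.
Proof.
exists (fun n k => a *: coef f n k); have [N [d h]] := coef_bounded f.
by exists N, d => n k /h ->; rewrite scaler0.
Defined.

Let laddA : associative ladd.
Proof. by move=> f g h; apply: logserP => n k /=; rewrite addrA. Qed.
Let laddC : commutative ladd.
Proof. by move=> f g; apply: logserP => n k /=; rewrite addrC. Qed.
Let ladd0 : left_id lzero ladd.
Proof. by move=> f; apply: logserP => n k /=; rewrite add0r. Qed.
Let laddN : left_inverse lzero lopp ladd.
Proof. by move=> f; apply: logserP => n k /=; rewrite addNr. Qed.

HB.instance Definition _ :=
  GRing.isZmodule.Build (logser V) laddA laddC ladd0 laddN.

Let lscaleA a b f : lscale a (lscale b f) = lscale (a * b) f.
Proof. by apply: logserP => n k /=; rewrite scalerA. Qed.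
Let lscale1 : left_id 1 lscale.
Proof. by move=> f; apply: logserP => n k /=; rewrite scale1r. Qed.
Let lscaleDr : right_distributive lscale +%R.
Proof. by move=> a f g; apply: logserP => n k /=; rewrite scalerDr. Qed.
Let lscaleDl f : {morph lscale^~ f : a b / a + b}.
Proof. by move=> a b; apply: logserP => n k /=; rewrite scalerDl. Qed.

HB.instance Definition _ := GRing.Zmodule_isLmodule.Build K (logser V)
  lscaleA lscale1 lscaleDr lscaleDl.

Let coef_linear n k : linear (fun f => coef f n k).
Proof. by []. Qed.

Definition coefl n k : {linear logser V -> V} := mkhom (coef_linear n k).

Lemma coeflE n k f : coefl n k f = coef f n k. Proof. by []. Qed.

(* The constant series. *)
Definition lconst (v : V) : logser V.
Proof.
exists (fun n k => if (n == 0) && (k == 0)%N then v else 0).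
exists 0, 1%N => n k; case: eqP => [->|//]; rewrite ltxx /=.
by case: eqP => [->|].
Defined.

Let lderiv_fun f : logser V.
Proof.
exists (fun n k => (n + 1)%:~R *: coef f (n + 1) k
                   + k.+1%:R *: coef f (n + 1) k.+1).
have [N [d h]] := coef_bounded f.
exists (N - 1), d => n k hnk; rewrite !h ?scaler0 ?addr0 //.
  by case/orP: hnk => [hn|hk]; apply/orP; [left; rewrite -ltrBrDr|right; exact: leqW].
by case/orP: hnk => [hn|hk]; apply/orP; [left; rewrite -ltrBrDr|right].
Defined.
Let lderiv_linear : linear lderiv_fun.
Proof.
move=> a f g; apply: logserP => n k.
rewrite -[RHS]/(a *: coef (lderiv_fun f) n k + coef (lderiv_fun g) n k) /=.
by rewrite !scalerDr !scalerA ![_ * a]mulrC addrACA.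
Qed.

(* D_z = d/dz + z^-1 d/dzeta. *)
Definition Dz : {linear logser V -> logser V} := mkhom lderiv_linear.

Lemma coef_Dz f n k : coef (Dz f) n k =
  (n + 1)%:~R *: coef f (n + 1) k + k.+1%:R *: coef f (n + 1) k.+1.
Proof. by []. Qed.

End LogSeriesLmodule.

Arguments coefl {K V}.
Arguments Dz {K V}.

Section LogSeriesMap.
Variables (K : fieldType) (V W : lmodType K) (T : {linear V -> W}).

Let lmap_fun (f : logser V) : logser W.
Proof.
exists (fun n k => T (coef f n k)); have [N [d h]] := coef_bounded f.
by exists N, d => n k /h ->; rewrite linear0.
Defined.
Let lmap_linear : linear lmap_fun.
Proof.
by move=> a f g; apply: logserP => n k; rewrite /= linearP.
Qed.

Definition lmap : {linear logser V -> logser W} := mkhom lmap_linear.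

Lemma coef_lmap f n k : coef (lmap f) n k = T (coef f n k).
Proof. by []. Qed.

End LogSeriesMap.

Section LogSeriesSuper.
Variables (K : fieldType) (V : superType K).

Let lpar p : {linear logser V -> logser V} := lmap (par p).
Let lparK p q f : lpar p (lpar q f) = if p == q then lpar q f else 0.
Proof.
apply: logserP => n k; rewrite !coef_lmap parK; case: eqP => [_|_] //.
Qed.
Let lpar_sum f : lpar false f + lpar true f = f.
Proof.
by apply: logserP => n k; rewrite -coeflE linearD !coeflE !coef_lmap par_sum.
Qed.

HB.instance Definition _ := isSuper.Build K (logser V) lparK lpar_sum.

End LogSeriesSuper.

(* LF(V) = Hom(V, V((z))[zeta]) *)
Notation LF V := {linear V -> logser V}.

(** * Formal series in z_1, zeta_1, z_2, zeta_2 *)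

(* [((n1, k1), (n2, k2))] is the monomial
   z_1^n1 zeta_1^k1 z_2^n2 zeta_2^k2. *)
Definition monom2 := ((int * nat) * (int * nat))%type.

Section FormalSeries.
Variable K : fieldType.

(* Product of two formal series along a bilinear pairing. A sum over a set is
   the sum over the support of the summand, by convention 0 if the support is
   infinite; this case does not occur in the products and exponentials used
   below: theta12 involves only powers of z_2/z_1, the exponents of z_2 in
   Y(z_2)v are bounded below, and S is locally nilpotent (and symmetrically
   for theta21). *)
Definition fprod (A B : Type) (X : nmodType) (m : A -> B -> X)
    (f : monom2 -> A) (g : monom2 -> B) : monom2 -> X :=
  fun e => \sum_(d \in [set d : monom2 * monom2 | d.1 + d.2 = e]) m (f d.1) (g d.2).

Definition fone : monom2 -> K := fun e => (e == 0)%:R.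
Definition fpow (f : monom2 -> K) (n : nat) : monom2 -> K :=
  iter n (fprod *%R f) fone.

Definition z12 : monom2 -> K := fun e =>
  (e == ((1, 0%N), (0, 0%N)))%:R - (e == ((0, 0%N), (1, 0%N)))%:R.

Definition theta12 : monom2 -> K := fun e =>
  (e == ((0, 1%N), (0, 0%N)))%:R
  - \sum_(n \in [set n : nat | (0 < n)%N])
      (n%:R^-1 : K) * (e == ((- n%:Z, 0%N), (n%:Z, 0%N)))%:R.

Definition theta21 : monom2 -> K := fun e =>
  (e == ((0, 0%N), (0, 1%N)))%:R
  - \sum_(n \in [set n : nat | (0 < n)%N])
      (n%:R^-1 : K) * (e == ((n%:Z, 0%N), (- n%:Z, 0%N)))%:R.

(* e^{theta A} x *)
Definition fexp (X : lmodType K) (theta : monom2 -> K) (A : {linear X -> X}) (x : X) :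
    monom2 -> X :=
  fun e => \sum_(m \in [set: nat]) (fpow theta m e / m`!%:R) *: iter m A x.

End FormalSeries.

Arguments z12 {K}.
Arguments theta12 {K}.
Arguments theta21 {K}.

(** * Linear operators *)

Section Operators.
Variables (K : fieldType) (V : lmodType K).
Implicit Types A B : {linear V -> V}.

Definition hid : {linear V -> V} := idfun.

Definition comm A B : {linear V -> V} := hcomp A B - hcomp B A.

Definition locally_nilpotent A : Prop := forall v, exists n, iter n A v = 0.

Definition in_span (s : seq V) (v : V) : Prop :=
  exists c : 'I_(size s) -> K, v = \sum_i c i *: s`_i.

Definition locally_finite A : Prop :=
  forall v, exists s : seq V,
    in_span s v /\ forall u, in_span s u -> in_span s (A u).

(* Semisimplicity over an algebraically closed field: every vector is a sum of
   eigenvectors. *)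
Definition semisimple A : Prop :=
  forall v, exists (n : nat) (u : 'I_n -> V) (l : 'I_n -> K),
    v = \sum_i u i /\ forall i, A (u i) = l i *: u i.

Definition Jordan_Chevalley A As An : Prop :=
  [/\ A = As + An, comm As An = 0, semisimple As & locally_nilpotent An].

End Operators.

Arguments hid {K V}.

(** * Logarithmic vertex algebras *)

Section Braiding.
Variables (K : fieldType) (V : superType K).
Implicit Types A : {linear V \tensor V -> V \tensor V}.

Let V3 := V \tensor V \tensor V.

Definition op12 A : {linear V3 -> V3} := tmap A hid.
Definition op23 A : {linear V3 -> V3} :=
  hcomp tcossa (hcomp (tmap hid A) tassoc).
Definition op13 A : {linear V3 -> V3} :=
  hcomp (op23 flip) (hcomp (op12 A) (op23 flip)).

(* S is even, so that the supercommutators are commutators. *)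
Record is_braiding (S : {linear V -> V} \tensor {linear V -> V}) : Prop := {
  braiding_even : homog false S;
  braiding_flip : hcomp (tact S) flip = hcomp flip (tact S);
  braiding_12_23 : comm (op12 (tact S)) (op23 (tact S)) = 0;
  braiding_13_23 : comm (op13 (tact S)) (op23 (tact S)) = 0;
  braiding_12_13 : comm (op12 (tact S)) (op13 (tact S)) = 0 }.

End Braiding.

Section StateField.
Variables (K : fieldType) (V : superType K) (Y : {linear V -> LF V}).

(* The coefficient of z^n zeta^k in Y(z) : V \otimes V -> V((z))[zeta]. *)
Definition Ycoef (e : int * nat) : {linear V \tensor V -> V} :=
  hcomp (coefl e.1 e.2) (tlift Y).

(* Y(z_1)(I \otimes Y(z_2)) and Y(z_2)(I \otimes Y(z_1)). *)
Definition YY12 (e : monom2) : {linear V \tensor V \tensor V -> V} :=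
  hcomp (Ycoef e.1) (hcomp (tmap hid (Ycoef e.2)) tassoc).
Definition YY21 (e : monom2) : {linear V \tensor V \tensor V -> V} :=
  hcomp (Ycoef e.2) (hcomp (tmap hid (Ycoef e.1)) tassoc).

(* The mode a_(n+S). *)
Definition mode (a : V) (n : int) : {linear V -> V} :=
  hcomp (coefl (- n - 1) 0) (Y a).

End StateField.

Definition app (K : fieldType) (U W : lmodType K) (f : {linear U -> W}) (u : U) :=
  f u.

Record logVA (K : fieldType) := LogVA {
  carrier :> superType K;
  vacuum : carrier;
  translation : {linear carrier -> carrier};
  stateField : {linear carrier -> LF carrier};
  braiding : {linear carrier -> carrier} \tensor {linear carrier -> carrier};
  vacuum_even : homog false vacuum;
  translation_even : homog false translation;
  stateField_even : homog false stateField;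
  braiding_axioms : is_braiding braiding;
  vacuum_stateField : forall b, stateField vacuum b = lconst b;
  stateField_vacuum_regular : forall a n k, (n < 0) || (0 < k)%N ->
    coef (stateField a vacuum) n k = 0;
  stateField_vacuum_value : forall a, coef (stateField a vacuum) 0 0 = a;
  translation_vacuum : translation vacuum = 0;
  (* Ordinary commutator, as T is even. *)
  covariance : forall a b,
    lmap translation (stateField a b) - stateField a (translation b)
    = Dz (stateField a b);
  braiding_nilpotent : locally_nilpotent (tact braiding);
  locality : forall p q (a b : carrier), homog p a -> homog q b ->
    exists N : nat, forall c : carrier, forall e : monom2,
      fprod (@app _ _ _) (YY12 stateField)
        (fprod *:%R (fpow z12 N)
           (fexp theta12 (op12 (tact braiding)) (a \ox b \ox c))) e
      = ksign p q *:
        fprod (@app _ _ _) (YY21 stateField)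
          (fprod *:%R (fpow z12 N)
             (fexp theta21 (op12 (tact braiding)) (b \ox a \ox c))) e;
  (* Equality of maps to (V \otimes V)((z))[zeta], coefficient by coefficient. *)
  hexagon : forall e : int * nat,
    hcomp (tact braiding) (tmap (Ycoef stateField e) hid)
    = hcomp (tmap (Ycoef stateField e) hid)
        (op13 (tact braiding) + op23 (tact braiding)) }.

Section LogVATheory.
Variables (K : fieldType) (V : logVA K).

(* Y(z) : V \otimes V -> V((z))[zeta] *)
Definition Yz : {linear V \tensor V -> logser V} := tlift (stateField V).

Definition kerY (x : V \tensor V) : Prop := Yz x = 0.
Definition eq_mod_kerY (x y : V \tensor V) : Prop := kerY (x - y).

(* The sign rule is extended linearly to inhomogeneous a and D. *)
Definition is_derivation (D : {linear V -> V}) : Prop :=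
  forall a b, lmap D (stateField V a b) =
    stateField V (D a) b
    + \sum_p \sum_q ksign p q *: stateField V (par p a) (par q D b).

(* L_n = omega_(n+1+S) *)
Definition Vir (omega : V) (n : int) : {linear V -> V} :=
  mode (stateField V) omega (n + 1).

Record is_conformal (omega : V) (c : K) : Prop := {
  omega_even : homog false omega;
  omega_S : forall v, tact (braiding V) (omega \ox v) = 0;
  Vir_rel : forall m n, comm (Vir omega m) (Vir omega n) =
    (m - n)%:~R *: Vir omega (m + n)
    + (if m + n == 0 then (m ^+ 3 - m)%:~R / 12%:R * c else 0) *: hid;
  Vir_translation : Vir omega (-1) = translation V;
  Vir_locally_finite : locally_finite (Vir omega 0) }.

End LogVATheory.

Arguments kerY {K} V x.
Arguments eq_mod_kerY {K} V x y.
Arguments is_derivation {K} V D.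
Arguments Vir {K} V omega n.
Arguments is_conformal {K} V omega c.

(* Main.v *)
Require Import Defs.
From HB Require Import structures.
From mathcomp Require Import all_boot all_order all_algebra.
From mathcomp Require Import complex.
From mathcomp Require Import zify ring.
From mathcomp Require Import all_classical all_reals.
Import Order.TTheory GRing.Theory Num.Theory.
Local Open Scope ring_scope.
Local Open Scope classical_set_scope.

Set Implicit Arguments.
Unset Strict Implicit.
Unset Printing Implicit Defensive.

(** Locality with c = 1, read at z_2 = 0, gives Y(z) = Y(z)|_{zeta=0} e^{-zeta S};
    read at z_1 = 0 and propagated by T it gives the skew-symmetry
    Y(z)P = e^{zT} Y(-z). As S kills omega, the pairs (omega, a) are local
    without logarithms: multiplied by a power of w - z, the commutator of Y(omega, w)
    and Y(a, z) vanishes. Applying this to a and, through skew-symmetry, to b, and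
    using that the binomial coefficients C(j, i), i < J, are linearly independent as
    functions of large j, one gets the commutator formula
      L_0 Y(a,z)b - Y(a,z)L_0 b - Y(L_0 a,z)b = z [T, Y(a,z)] b
                                              = (z d/dz + d/dzeta) Y(a,z)b.
    Hence the mode of z^n sends the eigenspaces of L_0^(s) for alpha and beta to the
    one for alpha + beta + n, and the nilpotent parts satisfy
      L_0^(n) Y(a,z)b - Y(a,z)L_0^(n) b - Y(L_0^(n) a,z)b = - Y(z) S(a (x) b).
    The failure of d + sum_i f_i g_i to be a derivation is
    sum_i Y(z)(f_i (x) g_i + (-1)^{p(f_i)} g_i (x) f_i). *)

(* [finfun] exports a type constructor of the same name. *)
Local Notation fprod := Defs.fprod.

(** * Products of formal series *)

(** With c = 1 the two sides of locality have different supports: the left one has no zeta_2 and no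
    negative power of z_2, the right one no zeta_1 and no negative power of z_1. Their common value
    obeys both restrictions. Moreover z_12 and theta_12, the expansion of log(z_1 - z_2), are killed
    by D_{z_1} + D_{z_2}, so this operator acts on the common value as T and links its edges z_2 = 0
    and z_1 = 0. The first reading also says that d/dzeta Y(z) = - Y(z) S. This is how S enters the
    equation for L_0^(n): the term z d/dz is absorbed by the eigenvalue shift n, and only the
    derivative in zeta is left. Classically the coefficients of the commutator of Y(omega, w) and
    Y(a, z) are identified by a uniqueness theorem for fields. Here everything is tested on one
    vector b: for large j the operator L_{j-1} kills a and b, so L_{j-1} Y(a, z) b gets two
    expansions in the functions C(j, i), whose coefficients are compared. As a sum with infinite
    support is 0 by convention, each manipulation of products needs finiteness; [homdeg] is the main
    source of it. *)

Definition fiber (e : monom2) : set (monom2 * monom2) := [set d | d.1 + d.2 = e].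

(** Powers of z_12 (D being the exponent) and of theta_12 (D = 0) involve only these monomials
    z_1^(D-j) zeta_1^k z_2^j. *)
Definition mon (D : int) (j k : nat) : monom2 := ((D - j%:Z, k), (j%:Z, 0%N)).

(* Total degree [D] in z_1 and z_2, no negative power of z_2, no zeta_2. *)
Definition homdeg (A : nmodType) (D : int) (g : monom2 -> A) :=
  forall e, g e <> 0 -> exists j k, e = mon D j k.

Definition cofactor (e : monom2) (D : int) (j k : nat) : monom2 :=
  ((e.1.1 - (D - j%:Z), (e.1.2 - k)%N), (e.2.1 - j%:Z, e.2.2)).

Lemma cofactorK e D j k : (k <= e.1.2)%N -> cofactor e D j k + mon D j k = e.
Proof.
case: e => [[n1 k1] [n2 k2]] /= hk; congr ((_, _), (_, _)) => /=.
- by rewrite subrK.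
- exact: subnK.
- by rewrite subrK.
- exact: addn0.
Qed.

Lemma monom2_addP (d d' e : monom2) : d + d' = e ->
  [/\ d.1.1 + d'.1.1 = e.1.1, (d.1.2 + d'.1.2)%N = e.1.2,
      d.2.1 + d'.2.1 = e.2.1 & (d.2.2 + d'.2.2)%N = e.2.2].
Proof. by move=> <-; split. Qed.

Lemma monom2_eq (d e : monom2) : d.1.1 = e.1.1 -> d.1.2 = e.1.2 ->
  d.2.1 = e.2.1 -> d.2.2 = e.2.2 -> d = e.
Proof. by case: d e => [[? ?] [? ?]] [[? ?] [? ?]] /= -> -> -> ->. Qed.

Lemma fiber_homdeg e D (d : monom2 * monom2) : fiber e d ->
  (exists j k, d.2 = mon D j k) ->
  exists j k, (k <= e.1.2)%N /\ d = (cofactor e D j k, mon D j k).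
Proof.
case: d => d d' /= /monom2_addP /= [h1 h2 h3 h4] [j [k ed]]; exists j, k.
rewrite {}ed /= in h1 h2 h3 h4 *; split; first by rewrite -h2 leq_addl.
congr pair; apply: monom2_eq => /=.
- by rewrite -h1 addrK.
- by rewrite -h2 addnK.
- by rewrite -h3 addrK.
- by rewrite -h4 addn0.
Qed.

Definition cells (e : monom2) (D : int) (J : nat) : seq (monom2 * monom2) :=
  [seq (cofactor e D j k, mon D j k) | j <- iota 0 J, k <- iota 0 e.1.2.+1].

Lemma cells_uniq e D J : uniq (cells e D J).
Proof.
apply: allpairs_uniq; rewrite ?iota_uniq // => -[j k] [j' k'] _ _ /=.
by case=> _ _ _ _ -> ->.
Qed.

Section FprodHomdeg.
Variables (A B X : nmodType) (m : A -> B -> X) (f : monom2 -> A) (g : monom2 -> B).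
Variables (D : int) (J : nat) (e : monom2).
Hypothesis m0 : forall a, m a 0 = 0.
Hypothesis gD : homdeg D g.
Hypothesis small : forall j k, (J <= j)%N -> (k <= e.1.2)%N ->
  m (f (cofactor e D j k)) (g (mon D j k)) = 0.

Let h d := m (f d.1) (g d.2).

Lemma supp_cells d : fiber e d -> h d <> 0 -> d \in cells e D J.
Proof.
move=> fd hd; have [|j [k [le_k ed]]] := @fiber_homdeg e D d fd.
  by apply: gD => g0; apply: hd; rewrite /h g0.
rewrite ed; apply: allpairs_f; rewrite mem_iota ?ltnS //= add0n ltnNge.
by apply/negP => /small /(_ le_k) h0; apply: hd; rewrite /h ed.
Qed.

Lemma finite_fprod_supp : finite_set [set d | fiber e d /\ h d <> 0].
Proof.
apply: (@sub_finite_set _ _ [set` cells e D J]); last exact: finite_seq.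
by move=> d [] fd hd; apply: supp_cells.
Qed.

(** For fixed e, the exponent k is at most that of zeta_1 in e, so only j could take infinitely many
    values, and [small] cuts it at J. This holds either because f has z_2-exponents bounded below or
    because g stops. *)
Lemma fprodE : fprod m f g e = \sum_(j < J) \sum_(k < e.1.2.+1)
  m (f (cofactor e D j k)) (g (mon D j k)).
Proof.
rewrite /fprod -/(fiber e) -/h.
have -> : \sum_(d \in fiber e) h d = \sum_(d \in [set` cells e D J]) h d.
  symmetry; apply: fsbig_widen => [d /allpairsP [[j k] [_ hk ->]]|d [fd]].
    by apply: cofactorK; move: hk; rewrite mem_iota ltnS => /andP [].
  by move=> nd; rewrite /=; apply: contrapT => hd; apply: nd; apply: supp_cells.
rewrite -fsbig_seq ?cells_uniq // big_allpairs_dep.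
rewrite -[in iota 0 J](subn0 J) -/(index_iota 0 J) big_mkord.
apply: eq_bigr => j _.
by rewrite -[in LHS](subn0 e.1.2.+1) -/(index_iota 0 _) big_mkord.
Qed.

End FprodHomdeg.

Lemma fprod_homdeg (A B X : nmodType) (m : A -> B -> X) (f : monom2 -> A)
    (g : monom2 -> B) (D D' : int) :
  (forall a, m a 0 = 0) -> (forall b, m 0 b = 0) ->
  homdeg D f -> homdeg D' g -> homdeg (D + D') (fprod m f g).
Proof.
move=> mr ml fD gD e; apply: contra_notP => he; rewrite /fprod fsbig1 // => -[d d'] /=.
move=> ee; apply: contrapT => hm; apply: he.
have [|j [k ed]] := fD d; first by move=> f0; apply: hm; rewrite f0.
have [|j' [k' ed']] := gD d'; first by move=> g0; apply: hm; rewrite g0.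
exists (j + j')%N, (k + k')%N; rewrite -ee ed ed'; apply: monom2_eq => //=.
by rewrite PoszD opprD addrACA.
Qed.

Lemma finite_fprod_homdeg (A B X : nmodType) (m : A -> B -> X) (f : monom2 -> A)
    (g : monom2 -> B) (D D' : int) e :
  (forall a, m a 0 = 0) -> (forall b, m 0 b = 0) ->
  homdeg D f -> homdeg D' g ->
  finite_set [set d | fiber e d /\ m (f d.1) (g d.2) <> 0].
Proof.
move=> mr ml fD gD; apply: (@finite_fprod_supp _ _ _ m f g D' `|e.2.1|.+1) => //.
move=> j k hj hk; case: (pselect (f (cofactor e D' j k) = 0)) => [->//|].
by move=> /fD [j' [k' []]] _ _ he _; exfalso; lia.
Qed.

(** * Leibniz rule for D_{z_1} + D_{z_2} *)

Lemma shift_inj (s : monom2) : injective (fun d : monom2 => d + s).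
Proof.
move=> [[n1 k1] [n2 k2]] [[n1' k1'] [n2' k2']].
move: s => [[a b] [c d]] /monom2_addP /= [/addIr -> /addIn -> /addIr -> /addIn ->].
by [].
Qed.

(* With w an exponent, this is the partial derivative in that variable
   followed by a monomial shift. *)
Definition wderiv (T : zmodType) (w : monom2 -> int) (s : monom2) (f : monom2 -> T) :
    monom2 -> T := fun e => f (e + s) *~ w (e + s).

Definition mz1 : monom2 := ((1, 0%N), (0, 0%N)).
Definition mz1l : monom2 := ((1, 1%N), (0, 0%N)).
Definition mz2 : monom2 := ((0, 0%N), (1, 0%N)).
Definition mz2l : monom2 := ((0, 0%N), (1, 1%N)).

(* D_{z_1} + D_{z_2} *)
Definition delta (T : zmodType) (f : monom2 -> T) : monom2 -> T := fun e =>
  wderiv (fun d => d.1.1) mz1 f e + wderiv (fun d => d.1.2%:Z) mz1l f e +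
  (wderiv (fun d => d.2.1) mz2 f e + wderiv (fun d => d.2.2%:Z) mz2l f e).

Lemma deltaE (T : zmodType) (f : monom2 -> T) n1 k1 n2 k2 :
  delta f ((n1, k1), (n2, k2)) =
    f ((n1 + 1, k1), (n2, k2)) *~ (n1 + 1) +
    f ((n1 + 1, k1.+1), (n2, k2)) *+ k1.+1 +
    (f ((n1, k1), (n2 + 1, k2)) *~ (n2 + 1) +
     f ((n1, k1), (n2 + 1, k2.+1)) *+ k2.+1).
Proof.
have e0 (n : nat) : (n + 0)%N = n by rewrite addn0.
have e1 (n : nat) : (n + 1)%N = n.+1 by rewrite addn1.
rewrite /delta /wderiv /mz1 /mz1l /mz2 /mz2l.
rewrite -[((n1, k1), (n2, k2)) + ((1, 0%N), (0, 0%N))]/((n1 + 1, (k1 + 0)%N), (n2 + 0, (k2 + 0)%N)).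
rewrite -[((n1, k1), (n2, k2)) + ((1, 1%N), (0, 0%N))]/((n1 + 1, (k1 + 1)%N), (n2 + 0, (k2 + 0)%N)).
rewrite -[((n1, k1), (n2, k2)) + ((0, 0%N), (1, 0%N))]/((n1 + 0, (k1 + 0)%N), (n2 + 1, (k2 + 0)%N)).
rewrite -[((n1, k1), (n2, k2)) + ((0, 0%N), (1, 1%N))]/((n1 + 0, (k1 + 0)%N), (n2 + 1, (k2 + 1)%N)).
by rewrite !e0 !e1 !addr0 -!pmulrn.
Qed.

Lemma additive0 (A X : zmodType) (h : A -> X) : {morph h : x y / x + y} -> h 0 = 0.
Proof. by move=> hD; apply: (addrI (h 0)); rewrite -hD !addr0. Qed.

Lemma additive_mulrz (A X : zmodType) (h : A -> X) : {morph h : x y / x + y} ->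
  forall a n, h (a *~ n) = h a *~ n.
Proof.
move=> hD a n.
have hN x : h (- x) = - h x by apply: (addrI (h x)); rewrite -hD !subrr (additive0 hD).
have hM k : h (a *+ k) = h a *+ k.
  by elim: k => [|k ih]; rewrite ?mulr0n ?mulrS ?hD ?ih // (additive0 hD).
by case: n => n; rewrite ?NegzE ?mulrNz -!pmulrn ?hN hM.
Qed.

Section Leibniz.
Variables (A B X : zmodType) (m : A -> B -> X).
Hypothesis mDl : forall b, {morph m^~ b : x y / x + y}.
Hypothesis mDr : forall a, {morph m a : x y / x + y}.

Let ml0 b : m 0 b = 0. Proof. exact: additive0 (mDl b). Qed.
Let mr0 a : m a 0 = 0. Proof. exact: additive0 (mDr a). Qed.
Let mMl a b n : m (a *~ n) b = m a b *~ n. Proof. exact: additive_mulrz (mDl b) a n. Qed.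
Let mMr a b n : m a (b *~ n) = m a b *~ n. Proof. exact: additive_mulrz (mDr a) b n. Qed.

(** The weight of a product monomial is the sum of the weights of its factors; each half of the sum
    is then reindexed by shifting one factor by s. As zeta-exponents are natural numbers, the shift
    is not onto, but the monomials that it misses have weight 0. *)
Lemma wderiv_fprod (w : monom2 -> int) (s : monom2) (f : monom2 -> A) (g : monom2 -> B) e :
  {morph w : x y / x + y} ->
  (forall d, w d <> 0 -> exists d0, d = d0 + s) ->
  finite_set [set d | fiber (e + s) d /\ m (f d.1) (g d.2) <> 0] ->
  wderiv w s (fprod m f g) e =
    fprod m (wderiv w s f) g e + fprod m f (wderiv w s g) e.
Proof.
move=> wD ws; have sI : injective (fun d : monom2 => d + s) := @shift_inj s.
set P := [set d | _] => finP; rewrite {1}/wderiv.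
have PE (h : monom2 * monom2 -> X) :
    (forall d, m (f d.1) (g d.2) = 0 -> h d = 0) ->
    \sum_(d \in P) h d = \sum_(d \in fiber (e + s)) h d.
  move=> h0; apply: fsbig_widen => [d []//|d [/= fd nP]].
  by apply: h0; apply: contrapT => hd; apply: nP.
rewrite {1}/fprod -/(fiber _) -PE //.
have -> : (\sum_(d \in P) m (f d.1) (g d.2)) *~ w (e + s) =
    \sum_(d \in P) (m (f d.1 *~ w d.1) (g d.2) + m (f d.1) (g d.2 *~ w d.2)).
  rewrite !fsbig_finite //= mulrz_suml; apply: eq_big_seq => d.
  rewrite in_fset_set // inE => -[/= <- _].
  by rewrite wD mulrzDr mMl mMr.
rewrite fsbig_split //; congr (_ + _); rewrite PE; try by move=> d; rewrite ?mMl ?mMr => ->; rewrite mul0rz.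
- pose Q := [set d | fiber (e + s) d /\ exists d0, d.1 = d0 + s].
  have -> : \sum_(d \in fiber (e + s)) m (f d.1 *~ w d.1) (g d.2) =
      \sum_(d \in Q) m (f d.1 *~ w d.1) (g d.2).
    symmetry; apply: fsbig_widen => [d []//|d [/= fd nQ]].
    have [->|/eqP/ws wd] := eqVneq (w d.1) 0; first by rewrite mulr0z ml0.
    by case: nQ.
  pose h (d : monom2 * monom2) := (d.1 + s, d.2).
  rewrite (@reindex_fsbig _ _ _ _ _ h (fiber e) Q) //; split.
  + move=> [d d'] /= fd; split; last by exists d.
    by rewrite /fiber /= -fd addrAC.
  + move=> [d1 d1'] [d2 d2'] _ _ E.
    have E1 : (h (d1, d1')).1 = (h (d2, d2')).1 by rewrite E.
    have E2 : (h (d1, d1')).2 = (h (d2, d2')).2 by rewrite E.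
    by congr pair; [apply: sI; exact: E1|exact: E2].
  + move=> [d d'] [/= fd [d0 ed]]; exists (d0, d') => //=; last by rewrite /h ed.
    by apply: sI; rewrite addrAC -ed.
- pose Q := [set d | fiber (e + s) d /\ exists d0, d.2 = d0 + s].
  have -> : \sum_(d \in fiber (e + s)) m (f d.1) (g d.2 *~ w d.2) =
      \sum_(d \in Q) m (f d.1) (g d.2 *~ w d.2).
    symmetry; apply: fsbig_widen => [d []//|d [/= fd nQ]].
    have [->|/eqP/ws wd] := eqVneq (w d.2) 0; first by rewrite mulr0z mr0.
    by case: nQ.
  pose h (d : monom2 * monom2) := (d.1, d.2 + s).
  rewrite (@reindex_fsbig _ _ _ _ _ h (fiber e) Q) //; split.
  + move=> [d d'] /= fd; split; last by exists d'.
    by rewrite /fiber /= -fd addrA.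
  + move=> [d1 d1'] [d2 d2'] _ _ E.
    have E1 : (h (d1, d1')).1 = (h (d2, d2')).1 by rewrite E.
    have E2 : (h (d1, d1')).2 = (h (d2, d2')).2 by rewrite E.
    by congr pair; [exact: E1|apply: sI; exact: E2].
  + move=> [d d'] [/= fd [d0 ed]]; exists (d, d0) => //=; last by rewrite /h ed.
    by apply: sI; rewrite -addrA -ed.
Qed.

(** Additivity of [fprod] can fail when a support is infinite, the sum being 0 by convention. This
    condition restores it, and it passes to derivatives and sums. *)
Definition finite_fibers (f : monom2 -> A) (g : monom2 -> B) :=
  forall e, finite_set [set d | fiber e d /\ m (f d.1) (g d.2) <> 0].

Lemma finite_fibers_wderivl w s f g :
  finite_fibers f g -> finite_fibers (wderiv w s f) g.
Proof.
move=> fin e; pose h (d : monom2 * monom2) : monom2 * monom2 := (d.1 + s, d.2).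
have hI : injective h.
  move=> [d1 d1'] [d2 d2'] E.
  have E1 : (h (d1, d1')).1 = (h (d2, d2')).1 by rewrite E.
  have E2 : (h (d1, d1')).2 = (h (d2, d2')).2 by rewrite E.
  by congr pair; [apply: (@shift_inj s); apply: E1|apply: E2].
apply: sub_finite_set (finite_preimage (in2W hI) (fin (e + s))).
move=> [d d'] /= [fd hm]; split; first by rewrite /fiber /= -fd addrAC.
by move=> m0; apply: hm; rewrite /wderiv mMl m0 mul0rz.
Qed.

Lemma finite_fibers_wderivr w s f g :
  finite_fibers f g -> finite_fibers f (wderiv w s g).
Proof.
move=> fin e; pose h (d : monom2 * monom2) : monom2 * monom2 := (d.1, d.2 + s).
have hI : injective h.
  move=> [d1 d1'] [d2 d2'] E.
  have E1 : (h (d1, d1')).1 = (h (d2, d2')).1 by rewrite E.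
  have E2 : (h (d1, d1')).2 = (h (d2, d2')).2 by rewrite E.
  by congr pair; [apply: E1|apply: (@shift_inj s); apply: E2].
apply: sub_finite_set (finite_preimage (in2W hI) (fin (e + s))).
move=> [d d'] /= [fd hm]; split; first by rewrite /fiber /= -fd addrA.
by move=> m0; apply: hm; rewrite /wderiv mMr m0 mul0rz.
Qed.

Lemma finite_fibersDl f f' g : finite_fibers f g -> finite_fibers f' g ->
  finite_fibers (fun d => f d + f' d) g.
Proof.
move=> fin fin' e; have := conj (fin e) (fin' e); rewrite -finite_setU.
apply: sub_finite_set => d [fd hm] /=.
have [m0|hm'] := pselect (m (f d.1) (g d.2) = 0); last by left.
by right; split=> // m0'; apply: hm; rewrite mDl m0 m0' addr0.
Qed.

Lemma finite_fibersDr f g g' : finite_fibers f g -> finite_fibers f g' ->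
  finite_fibers f (fun d => g d + g' d).
Proof.
move=> fin fin' e; have := conj (fin e) (fin' e); rewrite -finite_setU.
apply: sub_finite_set => d [fd hm] /=.
have [m0|hm'] := pselect (m (f d.1) (g d.2) = 0); last by left.
by right; split=> // m0'; apply: hm; rewrite mDr m0 m0' addr0.
Qed.

Let fsum_split e (h h' : monom2 * monom2 -> X) :
  finite_set [set d | fiber e d /\ h d <> 0] ->
  finite_set [set d | fiber e d /\ h' d <> 0] ->
  \sum_(d \in fiber e) (h d + h' d) =
    \sum_(d \in fiber e) h d + \sum_(d \in fiber e) h' d.
Proof.
move=> fin fin'; have := conj fin fin'; rewrite -finite_setU.
set P := _ `|` _ => finP.
have PE (u : monom2 * monom2 -> X) :
    (forall d, h d = 0 -> h' d = 0 -> u d = 0) ->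
    \sum_(d \in fiber e) u d = \sum_(d \in P) u d.
  move=> u0; symmetry; apply: fsbig_widen => [d [[]|[]]//|d [/= fd nP]].
  apply: u0; apply: contrapT => hd; apply: nP; first by left.
  by right.
by rewrite !PE ?fsbig_split //= => d -> ->; rewrite addr0.
Qed.

Lemma fprodDl f f' g e : finite_fibers f g -> finite_fibers f' g ->
  fprod m (fun d => f d + f' d) g e = fprod m f g e + fprod m f' g e.
Proof.
move=> fin fin'; rewrite /fprod -fsum_split //.
by apply: eq_fsbigr => d _; rewrite mDl.
Qed.

Lemma fprodDr f g g' e : finite_fibers f g -> finite_fibers f g' ->
  fprod m f (fun d => g d + g' d) e = fprod m f g e + fprod m f g' e.
Proof.
move=> fin fin'; rewrite /fprod -fsum_split //.
by apply: eq_fsbigr => d _; rewrite mDr.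
Qed.

Lemma delta_fprod f g e : finite_fibers f g ->
  delta (fprod m f g) e = fprod m (delta f) g e + fprod m f (delta g) e.
Proof.
move=> fin; rewrite /delta.
have Fl := finite_fibers_wderivl; have Fr := finite_fibers_wderivr.
have Dl := finite_fibersDl; have Dr := finite_fibersDr.
rewrite !(fprodDl, fprodDr); do ?[exact: Fl|exact: Fr|apply: Dl|apply: Dr].
have lem w s : {morph w : x y / x + y} ->
   (forall d, w d <> 0 -> exists d0, d = d0 + s) ->
   wderiv w s (fprod m f g) e =
    fprod m (wderiv w s f) g e + fprod m f (wderiv w s g) e.
  by move=> wD ws; exact: wderiv_fprod.
rewrite !lem //; first by rewrite [X in X + _ = _]addrACA [X in _ + X = _]addrACA [LHS]addrACA.
- move=> [[n1 k1] [n2 [//|k2]]] _; exists ((n1, k1), (n2 - 1, k2)).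
  by apply: monom2_eq => /=; rewrite ?addr0 ?subrK // -[RHS]/(k2 + 1)%N addn1.
- move=> [[n1 k1] [n2 k2]] _; exists ((n1, k1), (n2 - 1, k2)).
  by apply: monom2_eq => /=; rewrite ?addr0 ?subrK.
- move=> [[n1 [//|k1]] [n2 k2]] _; exists ((n1 - 1, k1), (n2, k2)).
  by apply: monom2_eq => /=; rewrite ?addr0 ?subrK // -[RHS]/(k1 + 1)%N addn1.
- move=> [[n1 k1] [n2 k2]] _; exists ((n1 - 1, k1), (n2, k2)).
  by apply: monom2_eq => /=; rewrite ?addr0 ?subrK.
Qed.

End Leibniz.

(** * Powers of z_12 and of theta_12 *)

Lemma homdeg_out (A : nmodType) D (f : monom2 -> A) n1 k1 n2 k2 : homdeg D f ->
  [|| n2 < 0, n1 + n2 != D | (0 < k2)%N] -> f ((n1, k1), (n2, k2)) = 0.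
Proof.
move=> fD he; apply: contrapT => /fD [j [k []]] e1 _ e2 e3; move: he.
by rewrite e1 e2 e3 subrK eqxx.
Qed.

Lemma monE D n1 k1 (n2 : nat) : n1 + n2%:Z = D ->
  ((n1, k1), (n2%:Z, 0%N)) = mon D n2 k1.
Proof. by move=> <-; rewrite /mon addrK. Qed.

Lemma delta_homdeg (A : zmodType) D (f : monom2 -> A) : homdeg D f ->
  (forall j k : nat, f (mon D j k) *~ (D - j%:Z) + f (mon D j k.+1) *+ k.+1 +
     f (mon D j.+1 k) *+ j.+1 = 0) -> forall e, delta f e = 0.
Proof.
move=> fD H [[n1 k1] [n2 k2]]; rewrite deltaE.
rewrite [f (_, (_, k2.+1))](homdeg_out _ fD) ?ltn0Sn ?orbT // mul0rn addr0.
case: k2 => [|k2]; last first.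
  by rewrite !(homdeg_out _ fD) ?ltn0Sn ?orbT // !mul0rz mul0rn !addr0.
have [eD|nD] := eqVneq (n1 + n2 + 1) D; last first.
  rewrite !(homdeg_out _ fD) ?mul0rz ?mul0rn ?addr0 //.
  - by rewrite addrA nD orbT.
  - by rewrite addrAC nD orbT.
  - by rewrite addrAC nD orbT.
case: n2 eD => [j|j] eD; last first.
  rewrite ![f (_, (Negz j, _))](homdeg_out _ fD) // mul0rz mul0rn !add0r.
  (* [Negz 0] is the exponent -1: there f is taken at z_2^0 and may be nonzero, but its weight, the
     exponent plus 1, is 0. *)
  case: j eD => [|j] eD; first by rewrite (_ : Negz 0 + 1 = 0) // mulr0z.
  by rewrite (homdeg_out _ fD) ?mul0rz.
have e1 : n1 + 1 + j%:Z = D by rewrite addrAC.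
have e2 : n1 + (j.+1)%:Z = D by rewrite -addn1 PoszD addrA.
rewrite -PoszD addn1 !(monE _ e1) !(monE _ e2) -pmulrn.
by rewrite -[RHS](H j k1) -e1 addrK.
Qed.

Lemma fprod0l (A B : Type) (X : nmodType) (m : A -> B -> X) f g e :
  (forall d d', m (f d) (g d') = 0) -> fprod m f g e = 0.
Proof. by move=> h; rewrite /fprod fsbig1. Qed.

Section Powers.
Variable K : numFieldType.

Lemma fpowS (f : monom2 -> K) n : fpow f n.+1 = fprod *%R f (fpow f n).
Proof. by []. Qed.

Lemma fone_homdeg : homdeg 0 (fone K).
Proof.
move=> e; rewrite /fone; case: eqP => // -> _; exists 0%N, 0%N.
by rewrite /mon subr0.
Qed.

Lemma fone_mon j k : fone K (mon 0 j k) = ((j == 0%N) && (k == 0%N))%:R.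
Proof.
rewrite /fone; congr (nat_of_bool _)%:R; apply/eqP/andP => [|[/eqP-> /eqP->]].
  by case=> _ -> ->.
by rewrite /mon subr0.
Qed.

Lemma delta_fone e : delta (fone K) e = 0.
Proof.
apply: (delta_homdeg fone_homdeg) => j k; rewrite !fone_mon andbF mul0rn.
by case: j => [|j]; rewrite /= ?subr0 ?mulr0z ?mul0rz ?mul0rn !addr0.
Qed.

Lemma fpow_homdeg D (f : monom2 -> K) n : homdeg D f -> homdeg (D *+ n) (fpow f n).
Proof.
move=> fD; elim: n => [|n ih]; first by rewrite mulr0n; exact: fone_homdeg.
by rewrite mulrS fpowS; apply: fprod_homdeg => // a; rewrite (mulr0, mul0r).
Qed.

Lemma delta_fpow D (f : monom2 -> K) n : homdeg D f ->
  (forall e, delta f e = 0) -> forall e, delta (fpow f n) e = 0.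
Proof.
move=> fD df; elim: n => [|n ih] e; first exact: delta_fone.
rewrite fpowS delta_fprod.
- by rewrite !fprod0l ?addr0 // => d d'; rewrite ?df ?ih ?mul0r ?mulr0.
- by move=> b x y; rewrite mulrDl.
- by move=> b x y; rewrite mulrDr.
- move=> e'; exact: (finite_fprod_homdeg e' (@mulr0 _) (@mul0r _) fD (fpow_homdeg fD)).
Qed.

Lemma z12_homdeg : homdeg 1 (@z12 K).
Proof.
move=> e; rewrite /z12; case: (eqVneq e ((1, 0%N), (0, 0%N))) => [->|_] /=.
  by exists 0%N, 0%N.
case: (eqVneq e ((0, 0%N), (1, 0%N))) => [->|_] /=; last by rewrite subrr.
by exists 1%N, 0%N.
Qed.

Lemma z12_mon j k : z12 (mon 1 j k) =
  ((j == 0%N) && (k == 0%N))%:R - ((j == 1%N) && (k == 0%N))%:R :> K.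
Proof.
rewrite /z12; congr (_%:R - _%:R); congr nat_of_bool.
  by apply/eqP/andP => [[_ -> ->]//|[/eqP-> /eqP->]].
by apply/eqP/andP => [[_ -> ->]//|[/eqP-> /eqP->]].
Qed.

Lemma delta_z12 e : delta (@z12 K) e = 0.
Proof.
apply: (delta_homdeg z12_homdeg) => j k; rewrite !z12_mon !andbF subrr mul0rn addr0.
case: j => [|[|j]]; rewrite /= ?mulr1z ?subr0 ?sub0r.
- by case: (k == 0%N); rewrite ?mulr1n ?mulr0n ?oppr0 ?subrr ?addr0.
- by rewrite subrr mulr0z mul0rn addr0.
- by rewrite ?oppr0 mul0rz mul0rn addr0.
Qed.

Let tail (e : monom2) : K := \sum_(n \in [set n : nat | (0 < n)%N])
   (n%:R^-1 : K) * (e == ((- n%:Z, 0%N), (n%:Z, 0%N)))%:R.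

(** The sum starts at n = 1, so the coefficient at j = 0 is 0; this agrees with the convention that
    the inverse of 0 is 0. *)
Let tail_mon j k : tail (mon 0 j k) = if k == 0%N then j%:R^-1 else 0.
Proof.
have [->|nk] := eqVneq k 0%N; last first.
  rewrite /tail fsbig1 // => n _; case: eqP => [[_ k0 _]|]; last by rewrite mulr0.
  by rewrite k0 in nk.
have [->|j_gt0] := posnP j.
  rewrite /tail fsbig1 ?invr0 // => n /= n_gt0; case: eqP => [[_ h]|].
    by rewrite -h in n_gt0.
  by rewrite mulr0.
rewrite /tail -(fsbig_widen [set j]) ?fsbig_set1 //=.
- by rewrite /mon sub0r eqxx mulr1.
- by move=> n /= ->.
- move=> n [/= _ nn]; case: eqP => [[_ h]|]; last by rewrite mulr0.
  by case: nn.
Qed.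

Lemma theta12_mon j k : theta12 (mon 0 j k) =
  ((j == 0%N) && (k == 1%N))%:R - (if k == 0%N then j%:R^-1 else 0) :> K.
Proof.
rewrite /theta12 -/(tail _) tail_mon; congr (_%:R - _); congr nat_of_bool.
by apply/eqP/andP => [[_ -> ->]//|[/eqP-> /eqP->]]; rewrite /mon subr0.
Qed.

Lemma theta12_homdeg : homdeg 0 (@theta12 K).
Proof.
move=> e; apply: contra_notP => he; rewrite /theta12 -/(tail _).
have -> : tail e = 0.
  rewrite /tail fsbig1 // => n _; case: eqP => [ee|]; last by rewrite mulr0.
  by case: he; exists n, 0%N; rewrite /mon sub0r.
case: eqP => [ee|_]; last by rewrite subr0.
by case: he; exists 0%N, 1%N; rewrite /mon subr0.
Qed.

(** The derivative of zeta_1 is z_1^(-1), which cancels the first term of the z_2-derivative of the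
    tail; the later terms cancel against the z_1-derivative with index shifted by one. *)
Lemma delta_theta12 e : delta (@theta12 K) e = 0.
Proof.
apply: (delta_homdeg theta12_homdeg) => j k; rewrite !theta12_mon sub0r /= subr0.
case: k => [|k]; case: j => [|j] /=.
- by rewrite oppr0 mulr0z add0r invr1 sub0r !mulr1n subrr.
- rewrite !sub0r mul0rn addr0 mulrNz mulNrz opprK -pmulrn mulNrn.
  have VK i : i.+1%:R^-1 *+ i.+1 = 1 :> K by rewrite -[LHS]mulr_natr mulVf ?pnatr_eq0.
  by rewrite !VK subrr.
- by rewrite oppr0 mulr0z ?subrr !mul0rn !addr0.
- by rewrite ?subrr mul0rz !mul0rn !addr0.
Qed.

Lemma fpow_z12_mon n j k : fpow z12 n (mon n%:Z j k) =
  (if k == 0%N then (-1) ^+ j * 'C(n, j)%:R else 0) :> K.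
Proof.
elim: n j k => [|n ih] j k.
  rewrite -[fpow _ 0]/(fone K) fone_mon; case: k => [|k]; rewrite ?andbF // andbT.
  by case: j => [|j] /=; rewrite ?mul1r // bin0n mulr0.
rewrite fpowS (fprodE (D := n%:Z) (J := j.+1)).
- have zE i l : (i <= j)%N -> (l <= k)%N ->
    z12 (cofactor (mon n.+1%:Z j k) n%:Z i l) =
    ((j - i == 0)%N && (k - l == 0)%N)%:R - ((j - i == 1)%N && (k - l == 0)%N)%:R :> K.
    move=> hi hl; rewrite -z12_mon; congr z12.
    by apply: monom2_eq => //=; rewrite -subzn // intS; ring.
  rewrite exchange_big /= big_ord_recr /= big1 ?add0r; last first.
    move=> l _; apply: big1 => i _.
    rewrite zE; [|by rewrite -ltnS|exact: ltnW].
    by rewrite [(k - l)%N == 0%N]subn_eq0 leqNgt ltn_ord !andbF subrr mul0r.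
  rewrite big_ord_recr /= zE // !subnn eqxx /= subr0 mul1r ih.
  case: j zE => [|j] zE; first by rewrite big_ord0 add0r bin0 bin0.
  rewrite big_ord_recr /= big1 ?add0r; last first.
    move=> i _; rewrite zE ?subnn ?andbT //; last exact: leq_trans (ltnW (ltn_ord i)) (leqnSn j).
    have -> : (j.+1 - i == 0)%N = false by apply/negbTE/eqP; have := ltn_ord i; lia.
    have -> : (j.+1 - i == 1)%N = false by apply/negbTE/eqP; have := ltn_ord i; lia.
    by rewrite subrr mul0r.
  rewrite zE // subnn subSnn /= sub0r ih; case: k {zE} => [|k] /=.
    by rewrite binS natrD exprS; ring.
  by rewrite mulr0 addr0.
- by move=> a; rewrite mulr0.
- by have := fpow_homdeg (n := n) z12_homdeg; rewrite natz.
- move=> i l hi hl; rewrite (homdeg_out _ z12_homdeg) ?mul0r //=.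
  by apply/orP; left; lia.
Qed.

(** At z_2 = 0 only the term zeta_1 of theta_12 survives; so e^{theta_12 S} becomes e^{zeta_1 S}
    there. *)
Lemma fpow_theta12_mon0 n k : fpow theta12 n (mon 0 0 k) = (k == n)%:R :> K.
Proof.
elim: n k => [|n ih] k; first by rewrite -[fpow _ 0]/(fone K) fone_mon.
rewrite fpowS (fprodE (D := 0) (J := 1)).
- rewrite big_ord1.
  have tE l : theta12 (cofactor (mon 0 0 k) 0 0 l) = (k - l == 1)%N%:R :> K.
    have -> : cofactor (mon 0 0 k) 0 0 l = mon 0 0 (k - l) by [].
    by rewrite theta12_mon invr0 if_same subr0.
  case: k tE => [|k] tE; first by rewrite big_ord1 tE subnn mul0r.
  rewrite big_ord_recr /= tE subnn mul0r addr0 big_ord_recr /= tE subSnn mul1r ih.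
  rewrite eqSS big1 ?add0r // => i _; rewrite tE.
  have -> : (k.+1 - i == 1)%N = false by apply/negbTE/eqP; have := ltn_ord i; lia.
  by rewrite mul0r.
- by move=> a; rewrite mulr0.
- by have := fpow_homdeg (n := n) theta12_homdeg; rewrite mul0rn.
- move=> i l hi hl; rewrite (homdeg_out _ theta12_homdeg) ?mul0r //=.
  by apply/orP; left; lia.
Qed.

End Powers.

Lemma fpow_z12_homdeg (K : numFieldType) N : homdeg N%:Z (fpow (@z12 K) N).
Proof. by have := fpow_homdeg (n := N) (@z12_homdeg K); rewrite natz. Qed.

(** * Exchange of the two variables, and exponentials of theta_12 *)

Definition swapm (e : monom2) : monom2 := (e.2, e.1).

Lemma swapmK : involutive swapm. Proof. by case. Qed.
Lemma swapmD d d' : swapm (d + d') = swapm d + swapm d'. Proof. by []. Qed.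

Lemma fprod_swap (A B : Type) (X : nmodType) (m : A -> B -> X) f g e :
  fprod m (f \o swapm) (g \o swapm) e = fprod m f g (swapm e).
Proof.
rewrite /fprod -!/(fiber _) /=.
pose h (d : monom2 * monom2) := (swapm d.1, swapm d.2).
rewrite [RHS](@reindex_fsbig _ _ _ _ _ h (fiber e)) //; split.
- by move=> d <-.
- move=> [d1 d1'] [d2 d2'] _ _ E.
  have E1 : (h (d1, d1')).1 = (h (d2, d2')).1 by rewrite E.
  have E2 : (h (d1, d1')).2 = (h (d2, d2')).2 by rewrite E.
  by congr pair; apply: (can_inj swapmK).
- move=> [d d'] /= fd; exists (swapm d, swapm d'); last by rewrite /h !swapmK.
  by rewrite /fiber /= -swapmD; move: fd => /= ->; rewrite swapmK.
Qed.

Lemma scaler_fsum (K : fieldType) (X : lmodType K) (I : choiceType) (a : K)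
    (P : set I) (F : I -> X) : a != 0 ->
  a *: \sum_(i \in P) F i = \sum_(i \in P) a *: F i.
Proof.
move=> a0.
have -> : \sum_(i \in P) a *: F i =
    \sum_(i <- finite_support 0 P F) a *: F i.
  congr (bigop.body _ _ _); rewrite /finite_support !unlock.
  congr (finmap.enum_fset (fset_set _)); apply/seteqP; split=> i [Pi /= hi]; split=> //= F0.
    by apply: hi; rewrite F0 scaler0.
  by apply: hi; move/eqP: F0; rewrite scaler_eq0 (negbTE a0) /= => /eqP.
by rewrite scaler_sumr.
Qed.

Section Exponential.
Variable K : numFieldType.

Lemma delta_sumZ (X : lmodType K) M (c : 'I_M -> monom2 -> K) (v : 'I_M -> X) e :
  delta (fun e => \sum_(i < M) c i e *: v i) e = \sum_(i < M) delta (c i) e *: v i.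
Proof.
rewrite /delta /wderiv !mulrz_suml -!big_split /=.
by apply: eq_bigr => i _; rewrite !scalerMzl !scalerDl.
Qed.

Section Nilpotent.
Variables (X : lmodType K) (A : {linear X -> X}) (x : X) (M : nat).
Hypothesis AM : iter M A x = 0.

Lemma iter_linear_ge m : (M <= m)%N -> iter m A x = 0.
Proof.
by move=> /subnK <-; rewrite iterD AM; elim: (_ - _)%N => //= n ->; rewrite linear0.
Qed.

Lemma fexpE theta e :
  fexp theta A x e = \sum_(m < M) (fpow theta m e / m`!%:R) *: iter m A x.
Proof.
rewrite /fexp -(fsbig_widen [set` iota 0 M]) //=.
  by rewrite -fsbig_seq ?iota_uniq // -[iota 0 M]/(iota 0 M) -{1}(subn0 M)
     -/(index_iota 0 M) big_mkord.
move=> m [_ /= nm]; rewrite iter_linear_ge ?scaler0 // leqNgt.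
by apply/negP => mM; apply: nm; rewrite mem_iota add0n.
Qed.

Lemma fexp_homdeg : homdeg 0 (fexp theta12 A x).
Proof.
move=> e; apply: contra_notP => he; rewrite fexpE big1 // => m _.
suff -> : fpow theta12 m e = 0 :> K by rewrite mul0r scale0r.
apply: contrapT => hm; apply: he.
have := fpow_homdeg (n := m) (@theta12_homdeg K).
by rewrite mul0rn; apply.
Qed.

Lemma delta_fexp e : delta (fexp theta12 A x) e = 0.
Proof.
have -> : fexp theta12 A x = (fun e => \sum_(m < M)
    fpow theta12 m e *: ((m`!%:R : K)^-1 *: iter m A x)).
  by apply/funext => e'; rewrite fexpE; apply: eq_bigr => m _; rewrite scalerA.
rewrite delta_sumZ big1 // => m _.
by rewrite (delta_fpow _ (@theta12_homdeg K) (@delta_theta12 K)) scale0r.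
Qed.

Lemma fexp_mon0 k : fexp theta12 A x (mon 0 0 k) = (k`!%:R : K)^-1 *: iter k A x.
Proof.
rewrite fexpE; under eq_bigr do rewrite fpow_theta12_mon0.
have [kM|Mk] := ltnP k M.
  rewrite (bigD1 (Ordinal kM)) //= eqxx mul1r big1 ?addr0 // => m nm.
  suff -> : (k == m) = false by rewrite mul0r scale0r.
  by apply: negbTE; apply: contra nm => /eqP km; apply/eqP/val_inj.
rewrite iter_linear_ge // scaler0 big1 // => m _.
suff -> : (k == m) = false by rewrite mul0r scale0r.
by apply: negbTE; rewrite neq_ltn (leq_trans (ltn_ord m) Mk) orbT.
Qed.

End Nilpotent.

Lemma theta21_swap : @theta21 K = theta12 \o swapm.
Proof.
apply/funext => -[a b]; rewrite /theta21 /theta12 /=.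
congr ((nat_of_bool _)%:R - _).
  by apply/eqP/eqP => [[-> ->]|[-> ->]].
apply: eq_fsbigr => n _; congr (_ * (nat_of_bool _)%:R).
by apply/eqP/eqP => [[-> ->]|[-> ->]].
Qed.

Lemma fone_swap : fone K \o swapm = fone K.
Proof.
apply/funext => -[a b]; rewrite /fone /=; congr (nat_of_bool _)%:R.
by apply/eqP/eqP => [[-> ->]|[-> ->]].
Qed.

Lemma fpow_swap (f : monom2 -> K) n : fpow (f \o swapm) n = fpow f n \o swapm.
Proof.
elim: n => [|n ih]; first by rewrite -[RHS]/(fone K \o swapm) fone_swap.
by rewrite fpowS ih; apply/funext => e; rewrite fprod_swap.
Qed.

Lemma fexp_theta21 (X : lmodType K) (A : {linear X -> X}) (x : X) :
  fexp theta21 A x = fexp theta12 A x \o swapm.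
Proof.
apply/funext => e; rewrite /fexp theta21_swap; apply: eq_fsbigr => m _.
by rewrite fpow_swap.
Qed.

Lemma z12_swap : @z12 K \o swapm = fun e => - z12 e.
Proof.
apply/funext => -[a b]; rewrite /z12 /= opprB.
congr ((nat_of_bool _)%:R - (nat_of_bool _)%:R);
  by apply/eqP/eqP => [[-> ->]|[-> ->]].
Qed.

Lemma fpow_z12_swap n : fpow (@z12 K) n = fun e => (-1) ^+ n * fpow z12 n (swapm e).
Proof.
have -> : (fun e => (-1) ^+ n * fpow z12 n (swapm e)) =
    (fun e => (-1) ^+ n * fpow (fun e => - @z12 K e) n e).
  by apply/funext => e; rewrite -z12_swap fpow_swap.
elim: n => [|n ih]; apply/funext => e; first by rewrite mul1r.
rewrite !fpowS /fprod mulr_fsumr; apply: eq_fsbigr => d _.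
by rewrite {1}ih exprS; ring.
Qed.

End Exponential.

(** * Binomial sums *)

(** By Pascal's rule, subtracting the relation for j from the one for j + 1 leaves a relation of the
    same kind for the shifted sequence, with one unknown fewer; v 0 then follows from a single
    relation. *)
Lemma binomial_independence (V : zmodType) (J T : nat) (v : nat -> V) :
  (forall j, (T <= j)%N -> \sum_(i < J) v i *+ 'C(j, i) = 0) ->
  forall i, (i < J)%N -> v i = 0.
Proof.
elim: J v => [//|J ih] v H.
have vS i : (i < J)%N -> v i.+1 = 0.
  apply: (ih (fun i => v i.+1)) => j Tj.
  have := H j.+1 (leqW Tj); rewrite big_ord_recl bin0 mulr1n => H1.
  have := H j Tj; rewrite big_ord_recl bin0 mulr1n => H0.
  have : \sum_(i < J) v (bump 0 i) *+ 'C(j.+1, bump 0 i)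
       = \sum_(i < J) v (bump 0 i) *+ 'C(j, bump 0 i).
    by apply: (addrI (v 0%N)); rewrite H1 H0.
  move=> /eqP; rewrite -subr_eq0 -sumrB => /eqP E; rewrite -[RHS]E.
  apply: eq_bigr => k _.
  by rewrite /= /bump add1n binS mulrnDr addrAC subrr add0r.
case=> [|i] iJ; last exact: vS.
have := H T (leqnn T); rewrite big_ord_recl bin0 mulr1n big1 ?addr0 // => i _.
by rewrite /= /bump add1n vS ?mul0rn.
Qed.

Section Differences.
Variables (V : zmodType) (B : int -> int -> V).

(* If B i n is the coefficient of w^(-i-1) z^n in a series in w and z, then
   bdiff j s n is the one of w^(-s) z^n in its product by (w - z)^j. *)
Definition bdiff (j : nat) (s n : int) : V :=
  \sum_(l < j.+1) B (j%:Z - l%:Z - 1 + s) (n - l%:Z) *~ ((-1) ^+ l * 'C(j, l)%:Z).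

Lemma bdiff0 s n : bdiff 0 s n = B (s - 1) n.
Proof. by rewrite /bdiff big_ord1 /= subr0 bin0 mulr1z addrC subr0. Qed.

Lemma bdiffS j s n : bdiff j.+1 s n = bdiff j (s + 1) n - bdiff j s (n - 1).
Proof.
rewrite {1}/bdiff big_ord_recl /= bin0 mulr1z.
under eq_bigr => i _ do rewrite /= /bump add1n binS PoszD mulrDr mulrzDr.
rewrite big_split /= addrA; congr (_ + _).
  rewrite {1}/bdiff [RHS]big_ord_recl /= bin0 mulr1z; congr (_ + _).
    by congr (B _ _); rewrite intS; ring.
  rewrite [LHS]big_ord_recr /= (bin_small (ltnSn j)) mulr0 mulr0z addr0.
  apply: eq_bigr => i _; rewrite /= /bump add1n; congr (B _ _ *~ _).
  by rewrite [j.+1%:Z]intS; ring.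
rewrite /bdiff -sumrN; apply: eq_bigr => i _; rewrite -mulrNz; congr (B _ _ *~ _).
- by rewrite [j.+1%:Z]intS [i.+1%:Z]intS; ring.
- by rewrite [i.+1%:Z]intS; ring.
- by rewrite exprS; ring.
Qed.

(** Expand w^j = ((w - z) + z)^j and read the coefficient of w^(-s) z^n in the product with the
    series of B. *)
Lemma bdiff_inv j s n : B (j%:Z - 1 + s) n =
  \sum_(i < j.+1) bdiff i s (n - (j%:Z - i%:Z)) *+ 'C(j, i).
Proof.
elim: j s n => [|j ih] s n.
  by rewrite big_ord1 bin0 mulr1n subrr subr0 bdiff0 addrC sub0r.
have -> : j.+1%:Z - 1 + s = j%:Z - 1 + (s + 1) by rewrite intS; ring.
rewrite ih.
have E i m : bdiff i (s + 1) m = bdiff i.+1 s m + bdiff i s (m - 1).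
  by rewrite bdiffS subrK.
under eq_bigr do rewrite E mulrnDl.
rewrite big_split /= [RHS]big_ord_recl bin0 mulr1n.
under [in RHS]eq_bigr do rewrite /= /bump add1n binS mulrnDr.
rewrite big_split /= addrA addrC; congr (_ + _); last first.
  apply: eq_bigr => i _; congr (bdiff _ _ _ *+ _).
  by rewrite [j.+1%:Z]intS [i.+1%:Z]intS; ring.
rewrite big_ord_recl bin0 mulr1n; congr (_ + _).
  by congr bdiff; rewrite /= [j.+1%:Z]intS; ring.
rewrite [RHS]big_ord_recr /= (bin_small (ltnSn j)) mulr0n addr0; apply: eq_bigr => i _.
rewrite /= /bump add1n; congr (bdiff _ _ _ *+ _).
by rewrite [j.+1%:Z]intS [i.+1%:Z]intS; ring.
Qed.

Lemma bdiff_vanish N : (forall s n, bdiff N s n = 0) ->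
  forall j s n, (N <= j)%N -> bdiff j s n = 0.
Proof.
move=> H j s n /subnK <-; elim: (j - N)%N s n => [|i ih] s n; first exact: H.
by rewrite addSn bdiffS !ih subrr.
Qed.

End Differences.

(** * Divided powers of the translation operator *)

Section DividedPowers.
Variables (K : numFieldType) (V : lmodType K) (T : {linear V -> V}).

Definition divpow (r : nat) (v : V) : V := (r`!%:R : K)^-1 *: iter r T v.

Lemma divpow_linear r : linear (divpow r).
Proof.
move=> a u v; rewrite /divpow scalerA mulrC -scalerA -scalerDr; congr (_ *: _).
by elim: r => //= r ->; rewrite linearP.
Qed.
HB.instance Definition _ r :=
  GRing.isLinear.Build K V V *:%R (divpow r) (divpow_linear r).

Lemma divpow0 v : divpow 0 v = v. Proof. by rewrite /divpow invr1 scale1r. Qed.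

Lemma divpowS r v : T (divpow r v) = divpow r.+1 v *+ r.+1.
Proof.
rewrite /divpow linearZ /= -scaler_nat scalerA; congr (_ *: _).
by rewrite factS natrM invfM mulrA mulfV ?mul1r // pnatr_eq0.
Qed.

Lemma divpow_comm r v : divpow r (T v) = divpow r.+1 v *+ r.+1.
Proof. by rewrite -divpowS /divpow -iterSr /= linearZ. Qed.

Lemma mulrn_injS (u v : V) r : u *+ r.+1 = v *+ r.+1 -> u = v.
Proof.
rewrite -!scaler_nat => /scalerI; apply; by rewrite pnatr_eq0.
Qed.

(* The array E is determined by its first row. *)
Lemma translation_array (E : int -> int -> V) :
  (forall n m, T (E n m) = E (n + 1) m *~ (n + 1) + E n (m + 1) *~ (m + 1)) ->
  forall n m : nat, E n m = \sum_(j < m.+1)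
    divpow j (E (n%:Z + m%:Z - j%:Z) 0) *~ ((-1) ^+ (m - j) * 'C(n + m - j, n)%:Z).
Proof.
(* [TE] is the differential equation (d/dz_1 + d/dz_2) E = T E; the formula is the coefficient of
   z_1^n z_2^m in its solution e^{z_2 T} E(z_1 - z_2, 0). *)
move=> TE n m; elim: m n => [|m ih] n.
  by rewrite big_ord1 /= !subn0 addn0 binn divpow0 addr0 subr0 mulr1z.
have /eqP := TE n m; rewrite addrC -subr_eq => /eqP.
rewrite -!PoszD !addn1 -!pmulrn => /esym h; apply: (@mulrn_injS _ _ m).
pose D j := divpow j (E (n%:Z + m.+1%:Z - j%:Z) 0).
have eT : T (E n m) = \sum_(j < m.+2)
    D j *~ (j%:Z * ((-1) ^+ (m.+1 - j) * 'C(n + m.+1 - j, n)%:Z)).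
  rewrite ih linear_sum [RHS]big_ord_recl /= mul0r mulr0z add0r.
  apply: eq_bigr => j _; rewrite -scaler_int linearZ /= scaler_int.
  rewrite /= /bump add1n addnS !subSS /D divpowS pmulrn -mulrzA; congr (divpow _ (E _ _) *~ _).
  by rewrite [m.+1%:Z]intS [j.+1%:Z]intS; ring.
have eE : E (n%:Z + 1) m *~ (n%:Z + 1) = \sum_(j < m.+2)
    D j *~ ((n%:Z + 1) * ((-1) ^+ (m - j) * 'C(n + m.+1 - j, n.+1)%:Z)).
  rewrite -PoszD addn1 ih mulrz_suml [RHS]big_ord_recr /=.
  rewrite (_ : 'C(_, _) = 0%N) ?mulr0 ?mulr0z ?addr0; last by rewrite addnK bin_small.
  apply: eq_bigr => j _; rewrite -mulrzA mulrC addSnnS /D.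
  by congr (divpow _ (E _ _) *~ _); rewrite [m.+1%:Z]intS [n.+1%:Z]intS; ring.
have {}h : E n m.+1 *+ m.+1 = T (E n m) - E (n%:Z + 1) m *~ (n%:Z + 1).
  by rewrite -PoszD addn1 -pmulrn.
rewrite h eT eE -sumrB -sumrMnl; apply: eq_bigr => j _.
rewrite -mulrzBr -/(D j) pmulrn -mulrzA; congr (_ *~ _).
have [jm|mj] := leqP j m; last first.
  have -> : j = m.+1 :> nat by apply/eqP; rewrite eqn_leq mj -ltnS ltn_ord.
  by rewrite addnK subnn binn (bin_small (ltnSn n)) !mulr0 subr0 mulrC.
have hC : (n%:Z + 1) * 'C(n + m.+1 - j, n.+1)%:Z =
    (m.+1%:Z - j%:Z) * 'C(n + m.+1 - j, n)%:Z.
  rewrite -PoszD addn1 -PoszM mul_bin_left -addnBA ?(leqW jm) // addKn.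
  by rewrite PoszM subzn // leqW.
rewrite subSn // exprS (mulrCA (n%:Z + 1)) hC; ring.
Qed.

(** In generating form, L_{j-1} e^{zT} = e^{zT} sum_l C(j, l) z^l L_{j-l-1}: L_{j-1} goes with w^j,
    and moving it past e^{zT} replaces w by w + z. *)
Lemma iter_commutator (L : int -> {linear V -> V}) :
  (forall n v, L n (T v) = T (L n v) + L (n - 1) v *~ (n + 1)) ->
  forall (j r : nat) v, L (j%:Z - 1) (divpow r v) =
    \sum_(l < r.+1) divpow (r - l) (L (j%:Z - l%:Z - 1) v) *+ 'C(j, l).
Proof.
move=> LT j r; elim: r => [|r ih] v.
  by rewrite big_ord1 !divpow0 subr0 bin0 mulr1n.
apply: (@mulrn_injS _ _ r); rewrite -linearMn /= -divpow_comm ih.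
pose D l := divpow (r.+1 - l) (L (j%:Z - l%:Z - 1) v) *+ 'C(j, l).
have -> : (\sum_(l < r.+2) divpow (r.+1 - l) (L (j%:Z - l%:Z - 1) v) *+ 'C(j, l))
    *+ r.+1 = \sum_(l < r.+2) D l *+ (r.+1 - l) + \sum_(l < r.+2) D l *+ l.
  rewrite -big_split -sumrMnl; apply: eq_bigr => l _.
  by rewrite /= -mulrnDr subnK // -ltnS.
rewrite [\sum_(l < r.+2) D l *+ (r.+1 - l)]big_ord_recr.
rewrite [\sum_(l < r.+2) D l *+ l]big_ord_recl /= subnn !mulr0n addr0 add0r -big_split.
apply: eq_bigr => l _; rewrite LT linearD /= mulrnDl; congr (_ + _).
  by rewrite divpow_comm /D subSn ?leq_ord // mulrnAC.
rewrite /D /= /bump add1n subSS -scaler_int linearZ /= scaler_int.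
have -> : j%:Z - l%:Z - 1 - 1 = j%:Z - l.+1%:Z - 1 by rewrite [l.+1%:Z]intS; ring.
rewrite -!mulrnA pmulrn [RHS]pmulrn -mulrzA; congr (_ *~ _).
rewrite subrK mulnC mul_bin_left PoszM.
by have [lj|jl] := leqP l j; [rewrite subzn|rewrite bin_small // !mulr0].
Qed.

End DividedPowers.

(** Cauchy product reindexing with t = r - l; the vanishing of f completes the triangle to a
    rectangle. *)
Lemma triangle_sum (V : nmodType) (f : nat -> nat -> V) R M :
  (forall l t, (R <= t + l)%N -> f l t = 0) -> (R <= M)%N ->
  \sum_(r < R) \sum_(l < r.+1) f l (r - l)%N = \sum_(l < M) \sum_(t < R) f l t.
Proof.
move=> f0 RM.
under eq_bigr => r _ do
  rewrite (big_ord_widen M (fun l => f l (r - l)%N)) ?(leq_trans (ltn_ord r)) //.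
rewrite (exchange_big_dep predT) //=; apply: eq_bigr => l _.
rewrite -(big_mkord (fun r => l < r.+1)%N (fun r => f l (r - l)%N)).
rewrite -(big_mkord predT (f l)).
have [Rl|lR] := leqP R l.
  rewrite big1_seq ?big1_seq // => i /andP[h]; rewrite mem_index_iota /= => iR.
    by apply: f0; rewrite (leq_trans Rl) ?leq_addl.
  by move: h; rewrite ltnS leqNgt (leq_trans iR).
rewrite (big_cat_nat (leq0n l) (ltnW lR)) /= [X in X + _]big1_seq ?add0r; last first.
  by move=> i /andP[h]; rewrite mem_index_iota /= => il; rewrite ltnS leqNgt il in h.
rewrite -[in LHS](add0n l) big_addn.
rewrite [RHS](big_cat_nat (leq0n (R - l)) (leq_subr l R)) /= [X in _ = _ + X]big1_seq ?addr0.
  by apply: eq_big => i; rewrite ?addnK // ltnS leq_addl.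
by move=> i /=; rewrite mem_index_iota leq_subLR => /andP[h _]; apply: f0; rewrite addnC.
Qed.

Section CommutatorFormula.
Variables (K : numFieldType) (V : lmodType K) (T : {linear V -> V}).
Variable L : int -> {linear V -> V}.
Hypothesis LT : forall n v, L n (T v) = T (L n v) + L (n - 1) v *~ (n + 1).

(** Coefficient of z^m in e^{zT} F(-z), cut after R terms; it is used with R beyond the point where
    F (m - r) vanishes. *)
Definition skew_sum (R : nat) (m : int) (F : int -> V) : V :=
  \sum_(r < R) (-1) ^ (m - r%:Z) *: divpow T r (F (m - r%:Z)).

(* F n and F' i n stand for the z^n coefficients of Y(z)(b (x) a) and Y(z)(b (x) L_i a),
   G and G' for those of their flips, given by skew-symmetry. *)
Lemma skew_locality (F G : int -> V) (F' G' : int -> int -> V) (j : nat) :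
  (exists B : int, forall n, n < B -> F n = 0) ->
  (forall i, exists B : int, forall n, n < B -> F' i n = 0) ->
  (forall m R, (forall r, (R <= r)%N -> F (m - r%:Z) = 0) -> G m = skew_sum R m F) ->
  (forall i m R, (forall r, (R <= r)%N -> F' i (m - r%:Z) = 0) ->
     G' i m = skew_sum R m (F' i)) ->
  (forall n, \sum_(l < j.+1) (L (j%:Z - l%:Z - 1) (F (n - l%:Z))
     - F' (j%:Z - l%:Z - 1) (n - l%:Z)) *~ ((-1) ^+ l * 'C(j, l)%:Z) = 0) ->
  forall m, L (j%:Z - 1) (G m) =
    \sum_(l < j.+1) G' (j%:Z - l%:Z - 1) (m - l%:Z) *+ 'C(j, l).
Proof.
move=> [B FB] FB' GF GF' loc m; have [b bP] := choice FB'.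
(* One cut-off for F and for the finitely many series F' that occur: each lower bound depends on l,
   and a sum of distances dominates them all. *)
pose R := (absz (m - B)%R + \sum_(l < j.+1) absz (m - l%:Z - b (j%:Z - l%:Z - 1))%R).+1%N.
have F0 r : (R <= r)%N -> F (m - r%:Z) = 0.
  by move=> Rr; apply: FB; move: Rr; rewrite /R; lia.
have F'0 l r : (l < j.+1)%N -> (R <= r)%N -> F' (j%:Z - l%:Z - 1) (m - l%:Z - r%:Z) = 0.
  move=> lj Rr; apply: bP; move: Rr; rewrite /R (bigD1 (Ordinal lj)) //=; lia.
pose f l t := ((-1) ^ (m - t%:Z - l%:Z) : K) *:
  divpow T t (L (j%:Z - l%:Z - 1) (F (m - t%:Z - l%:Z))) *+ 'C(j, l).
have f0 l t : (R <= t + l)%N -> f l t = 0.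
  by move=> Rtl; rewrite /f -addrA -opprD -PoszD F0 // !linear0 mul0rn.
rewrite (GF m R F0) /skew_sum linear_sum /=.
transitivity (\sum_(r < R) \sum_(l < r.+1) f l (r - l)%N).
  apply: eq_bigr => r _; rewrite linearZ /= (iter_commutator LT) scaler_sumr.
  apply: eq_bigr => l _; rewrite /f -scalerMnr.
  suff -> : m - (r - l)%N%:Z - l%:Z = m - r%:Z by [].
  by rewrite -subzn ?leq_ord //; ring.
rewrite (triangle_sum (M := R + j.+1) f0) ?leq_addr //.
have -> : \sum_(l < R + j.+1) \sum_(t < R) f l t = \sum_(l < j.+1) \sum_(t < R) f l t.
  rewrite -(big_mkord predT (fun l => \sum_(t < R) f l t)).
  rewrite (big_cat_nat (leq0n j.+1) (leq_addl _ _)) big_mkord /= [X in _ + X]big1_seq ?addr0 //.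
  move=> l; rewrite mem_index_iota => /= /andP[jl _]; apply: big1 => t _.
  by rewrite /f bin_small // mulr0n.
pose f' l t := ((-1) ^ (m - t%:Z - l%:Z) : K) *:
  divpow T t (F' (j%:Z - l%:Z - 1) (m - t%:Z - l%:Z)) *+ 'C(j, l).
transitivity (\sum_(l < j.+1) \sum_(t < R) f' l t); last first.
  apply: eq_bigr => l _; rewrite (GF' _ (m - l%:Z) R); last first.
    by move=> r; exact: (F'0 _ _ (ltn_ord l)).
  rewrite /skew_sum -sumrMnl; apply: eq_bigr => t _.
  by rewrite /f' [m - l%:Z - t%:Z]addrAC.
rewrite exchange_big [RHS]exchange_big /=; apply: eq_bigr => t _.
apply/eqP; rewrite -subr_eq0 -sumrB; apply/eqP.
(* For each t the difference is the locality relation at exponent m - t. Skew-symmetry evaluates it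
   at -z, which turns (w - z)^j into the (w + z)^j coming from e^{zT}. *)
have := congr1 (fun v => (-1) ^ (m - t%:Z) *: divpow T t v) (loc (m - t%:Z)).
rewrite !linear0 linear_sum scaler_sumr /= => h; rewrite -[RHS]h; apply: eq_bigr => l _.
rewrite /f /f' -mulrnBl -scalerBr -linearB /=.
set w := L _ _ - _.
have -> : divpow T t (w *~ ((-1) ^+ l * 'C(j, l)%:Z)) =
    ((-1) ^+ l * 'C(j, l)%:R : K) *: divpow T t w.
  by rewrite -scaler_int linearZ /= intrM rmorphXn /= rmorphN1.
have -> : (-1 : K) ^ (m - t%:Z - l%:Z) = (-1) ^ (m - t%:Z) * (-1) ^+ l.
  by rewrite expfzDr ?oppr_eq0 ?oner_eq0 // -exprz_inv invrN1.
by rewrite -scaler_nat !scalerA; congr (_ *: _); ring.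
Qed.

(** For large j, L_{j-1} X_m(a, b) is expanded in C(j, i) in two ways: by [bdiff_inv], as L_{j-1} b
    = 0, and by the second hypothesis. Equating coefficients makes the i-th [bdiff] equal to
    X(L_{i-1} a, b). The conclusion is the case i = 1, where the factor w - z produces L_0 - z
    L_{-1}. *)
Lemma commutator_from_locality (X : int -> V -> V -> V) (a b : V) :
  (exists N, forall s n, bdiff (fun i n => L i (X n a b) - X n a (L i b)) N s n = 0) ->
  (exists N, forall (j : nat) m, (N <= j)%N -> L (j%:Z - 1) (X m a b) =
     \sum_(l < j.+1) X (m - l%:Z) (L (j%:Z - l%:Z - 1) a) b *+ 'C(j, l)) ->
  (exists N, forall j : nat, (N <= j)%N -> L (j%:Z - 1) a = 0 /\ L (j%:Z - 1) b = 0) ->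
  (forall n, X n a 0 = 0) -> (forall n, X n 0 b = 0) ->
  forall n, L 0 (X n a b) - X n a (L 0 b) - X n (L 0 a) b =
    L (-1) (X (n - 1) a b) - X (n - 1) a (L (-1) b).
Proof.
move=> [N1 loc] [N2 skew] [N3 ab0] Xr0 Xl0 n.
set B := fun i n => _ in loc.
(* The 2 ensures 1 < J, as the coefficients are compared at index 1. *)
pose J := (N1 + N2 + N3).+2%N.
pose k i m := bdiff B i 0 m - X m (L (i%:Z - 1) a) b.
have k0 i m : (J <= i)%N -> k i m = 0.
  move=> Ji; rewrite /k (bdiff_vanish loc) ?(ab0 i _).1 ?Xl0 ?subrr //; by rewrite /J in Ji *; lia.
have ksum (j : nat) m : (J <= j)%N ->
    \sum_(i < J) k i (m - (j%:Z - i%:Z)) *+ 'C(j, i) = 0.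
  move=> Jj; have E := skew j m; have E' := bdiff_inv B j 0 m.
  have -> : \sum_(i < J) k i (m - (j%:Z - i%:Z)) *+ 'C(j, i) =
      \sum_(i < j.+1) k i (m - (j%:Z - i%:Z)) *+ 'C(j, i).
    rewrite (big_ord_widen j.+1 (fun i => k i (m - (j%:Z - i%:Z)) *+ 'C(j, i))); last by rewrite leqW.
    rewrite big_mkcond; apply: eq_bigr => i _; case: ltnP => // Ji.
    by rewrite k0 ?mul0rn.
  rewrite /k; under eq_bigr do rewrite mulrnBl.
  rewrite sumrB -E' addr0 /B (ab0 j _).2 ?Xr0 ?subr0; last by rewrite /J in Jj *; lia.
  rewrite E; last by rewrite /J in Jj *; lia.
  rewrite -[X in _ - X](big_mkord predT (fun i => X (m - (j%:Z - i%:Z)) (L (i%:Z - 1) a) b *+ 'C(j, i))).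
  rewrite big_rev_mkord subn0 -sumrB big1 // => l _ /=.
  rewrite subSS bin_sub ?leq_ord // -subzn ?leq_ord //.
  suff -> : j%:Z - (j%:Z - l%:Z) = l%:Z by rewrite subrr.
  by rewrite opprB addrCA subrr addr0.
have k1 : k 1%N n = 0.
  (* The unknowns must not depend on j: for m = n - 1 + j the exponent m - (j - i) is n - 1 + i,
     which is n at i = 1. *)
  have := @binomial_independence _ J J (fun i => k i (n - 1 + i%:Z)) _ 1%N isT.
  rewrite subrK; apply=> j Jj.
  rewrite -[RHS](ksum j (n - 1 + j%:Z) Jj); apply: eq_bigr => i _.
  by congr (k _ _ *+ _); ring.
move: k1; rewrite /k bdiffS !bdiff0 /B /= => /eqP.
rewrite add0r subrr sub0r subr_eq0 => /eqP <-.
by rewrite opprB addrCA subrr addr0.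
Qed.

End CommutatorFormula.

(** * Consequences of locality *)

Section Parity.
Variable K : fieldType.

Lemma hom_homog (U W : superType K) (f : {linear U -> W}) p q u :
  homog p f -> homog q u -> homog (p (+) q) (f u).
Proof.
move=> fp uq; rewrite /homog -{1}fp par_homE (bigD1 q) //= uq big1 ?addr0; last first.
  by move=> r /negbTE nr; rewrite -uq parK nr !linear0.
rewrite parK eqxx -[in RHS]fp par_homE (bigD1 q) //= uq big1 ?addr0 //.
by move=> r /negbTE nr; rewrite -uq parK nr !linear0.
Qed.

Lemma even_homog (U W : superType K) (f : {linear U -> W}) q u :
  homog false f -> homog q u -> homog q (f u).
Proof. exact: hom_homog. Qed.

Lemma par_homog (U : superType K) p (u : U) : homog p (par p u).
Proof. by rewrite /homog parK eqxx. Qed.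

Lemma tensor_homog (U W : superType K) p q (u : U) (w : W) :
  homog p u -> homog q w -> homog (p (+) q) (u \ox w).
Proof.
move=> up wq; rewrite /homog par_tensorE (bigD1 p) //= up big1 ?addr0.
  by rewrite addbAC addbb wq.
by move=> r /negbTE nr; rewrite -up parK nr bilin0.
Qed.

Lemma tensor_homog_ind (U W : superType K) (Q : U \tensor W -> Prop) :
  Q 0 -> (forall x y, Q x -> Q y -> Q (x + y)) ->
  (forall p q u w, homog p u -> homog q w -> Q (u \ox w)) -> forall x, Q x.
Proof.
move=> Q0 QD Qh x; rewrite -(tclass_repr x) tclass_sum.
elim/big_rec: _ => // -[u w] y _ Qy; apply: (QD _ _ _ Qy) => /=.
rewrite -[u]par_sum -[w]par_sum bilinD !linearD /=.
by apply: (QD); apply: QD; apply: Qh; exact: par_homog.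
Qed.

Lemma tensor_homog_ext (U W : superType K) (X : lmodType K)
    (f g : {linear U \tensor W -> X}) :
  (forall p q u w, homog p u -> homog q w -> f (u \ox w) = g (u \ox w)) -> f = g.
Proof.
move=> h; apply: homP; elim/tensor_homog_ind => [|x y fx fy|]; last exact: h.
  by rewrite !linear0.
by rewrite !linearD fx fy.
Qed.

Lemma even_tensor_hom (U W X : superType K) (f : {linear U \tensor W -> X}) :
  (forall p q u w, homog p u -> homog q w -> homog (p (+) q) (f (u \ox w))) ->
  homog false f.
Proof.
move=> h; apply: tensor_homog_ext => p q u w up wq.
rewrite par_homE (bigD1 (p (+) q)) //= (tensor_homog up wq) h // big1 ?addr0 //.
by move=> r /negbTE nr; rewrite -(tensor_homog up wq) parK nr !linear0.
Qed.

Lemma hid_even (U : superType K) : homog false (@hid K U).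
Proof. by apply: homP => u; rewrite par_homE -[RHS]par_bigsum; apply: eq_bigr => q _; rewrite parK eqxx. Qed.

Lemma tmap_even (U W U' W' : superType K) (f : {linear U -> U'})
    (g : {linear W -> W'}) u w : homog false g ->
  tmap f g (u \ox w) = f u \ox g w.
Proof.
move=> g0; rewrite tmapE -[in RHS](par_bigsum u) linear_sum bilin_sum.
apply: eq_bigr => p _; rewrite (bigD1 false) //= g0 big1 ?addr0 ?scale1r //.
by case=> // _; rewrite -g0 parK hom0E linear0 scaler0.
Qed.

Lemma flip_homogE (U W : superType K) p q (u : U) (w : W) :
  homog p u -> homog q w -> flip (u \ox w) = ksign p q *: (w \ox u).
Proof.
move=> up wq; rewrite flipE (bigD1 p) //= (bigD1 q) //= up wq big1 ?addr0; last first.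
  by move=> r /negbTE nr; rewrite -wq parK nr bilin0 scaler0.
rewrite big1 ?addr0 // => r /negbTE nr; rewrite big1 // => r' _.
by rewrite -up parK nr linear0 scaler0.
Qed.

Lemma ksignK p q : ksign p q * ksign p q = 1 :> K.
Proof. by rewrite /ksign -expr2 sqrr_sign. Qed.

Lemma hom_mulrz (U W : lmodType K) (f : {linear U -> W}) n u : (f *~ n) u = f u *~ n.
Proof. by rewrite -[f *~ n]scaler_int homZE scaler_int. Qed.

End Parity.

(** * Coefficients of Y(z) and of the locality identity *)

Section LogVAFields.
Variables (K : numFieldType) (V : logVA K).

Local Notation Y := (stateField V).
Local Notation S := (tact (braiding V)).
Local Notation T := (translation V).
Local Notation one := (vacuum V).

Fact Yc_key : unit. Proof. by []. Qed.
Definition Yc (n : int) (k : nat) : {linear V \tensor V -> V} :=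
  locked_with Yc_key (Ycoef Y (n, k)).

Lemma Ycoef_Yc n k : Ycoef Y (n, k) = Yc n k.
Proof. by rewrite /Yc locked_withE. Qed.

Lemma YcE n k a b : Yc n k (a \ox b) = coef (Y a b) n k.
Proof. by rewrite -Ycoef_Yc /Ycoef /hcomp /= tliftE. Qed.

Lemma Yc_lower_bound k (x : V \tensor V) : exists B : int, forall n, n < B -> Yc n k x = 0.
Proof.
have [B [d h]] := coef_bounded (tlift Y x).
by exists B => n nB; rewrite -Ycoef_Yc /Ycoef /hcomp /= h ?nB.
Qed.

Lemma Ycoef_even e : homog false (Ycoef Y e).
Proof.
apply: even_tensor_hom => p q a b ap bq; case: e => n k.
rewrite Ycoef_Yc YcE.
have Yab := hom_homog (even_homog (stateField_even V) ap) bq.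
by rewrite /homog -{2}Yab.
Qed.

Lemma translation_Yc n k a b : T (Yc n k (a \ox b)) =
  Yc n k (a \ox T b) + (Yc (n + 1) k (a \ox b) *~ (n + 1)
    + Yc (n + 1) k.+1 (a \ox b) *+ k.+1).
Proof.
have := congr1 (fun s => coef s n k) (covariance a b).
rewrite coef_Dz scaler_int scaler_nat !YcE => <-.
by rewrite addrC -[coef (_ - _) n k]/(T (coef (Y a b) n k) - coef (Y a (T b)) n k) subrK.
Qed.

(** Fixing the last vector c makes the iterated field a series of linear maps on V (x) V, so that it
    can be paired with series in arbitrary tensors, not only in a (x) b. *)
Definition YYc (c : V) (d : monom2) : {linear V \tensor V -> V} :=
  hcomp (YY12 Y d) (mkhom (fun a (x y : V \tensor V) => bilinP (tpure _ V) a x y c)).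

Arguments YYc : simpl never.

Lemma YYcE c n k m l a b : YYc c ((n, k), (m, l)) (a \ox b) =
  Yc n k (a \ox Yc m l (b \ox c)).
Proof.
rewrite -[LHS]/(Ycoef Y (n, k) (tmap hid (Ycoef Y (m, l)) (tassoc (a \ox b \ox c)))).
by rewrite tassocE tmap_even ?Ycoef_Yc //; rewrite -Ycoef_Yc; exact: Ycoef_even.
Qed.

Lemma YYc_vacuum_out n k m l : (m < 0) || (0 < l)%N -> YYc one ((n, k), (m, l)) = 0.
Proof.
move=> h; apply: tensor_ext => a b.
by rewrite YYcE [Yc m l _]YcE stateField_vacuum_regular // !linear0.
Qed.

Lemma YYc_vacuum0 n k : YYc one ((n, k), (0, 0%N)) = Yc n k.
Proof. by apply: tensor_ext => a b; rewrite YYcE [Yc 0 _ _]YcE stateField_vacuum_value. Qed.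

(** Covariance turns D_{z_1} and D_{z_2} into commutators with T; their sum telescopes to T on the
    outside, since T kills the vacuum. *)
Lemma delta_YYc_vacuum d : delta (YYc one) d = hcomp T (YYc one d).
Proof.
case: d => [[n k] [m l]]; rewrite deltaE; apply: tensor_ext => a b.
rewrite -[RHS]/(T (YYc one ((n, k), (m, l)) (a \ox b))).
rewrite !pmulrn !homDE !hom_mulrz -!pmulrn !YYcE.
rewrite translation_Yc translation_Yc translation_vacuum !linear0 add0r.
rewrite addrC; congr (_ + _).
rewrite -!scaler_int -!scaler_nat (linearD (tpure V V a)) linearD.
by rewrite !(linearZ_LR (tpure V V a)) !linearZ_LR.
Qed.

Definition expS (N : nat) (x : V \tensor V) : monom2 -> V \tensor V :=
  fprod *:%R (fpow z12 N) (fexp theta12 S x).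

Lemma expS_homdeg N x : homdeg N%:Z (expS N x).
Proof.
have [M SM] := braiding_nilpotent x; rewrite -[N%:Z]addr0.
apply: (fprod_homdeg _ _ (@fpow_z12_homdeg K N) (fexp_homdeg SM)) => a.
- exact: scaler0.
- exact: scale0r.
Qed.

Lemma delta_expS N x e : delta (expS N x) e = 0.
Proof.
have [M SM] := braiding_nilpotent x; rewrite delta_fprod.
- rewrite !fprod0l ?addr0 // => d d'; rewrite ?(delta_fexp SM) ?scaler0 //.
  by rewrite (delta_fpow _ (@z12_homdeg K) (@delta_z12 K)) scale0r.
- by move=> b a a'; rewrite scalerDl.
- by move=> a b b'; rewrite scalerDr.
- move=> e'; apply: (finite_fprod_homdeg _ _ _ (@fpow_z12_homdeg K N) (fexp_homdeg SM)) => a.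
  + exact: scaler0.
  + exact: scale0r.
Qed.

End LogVAFields.

Arguments Yc {K} V n k : simpl never.
Arguments YYc {K} V c d : simpl never.

Lemma iter_linear0 (K : fieldType) (X : lmodType K) (f : {linear X -> X}) m :
  iter m f 0 = 0.
Proof. by elim: m => //= m ->; rewrite linear0. Qed.

Lemma iter_linearD (K : fieldType) (X : lmodType K) (f : {linear X -> X}) m :
  {morph iter m f : x y / x + y}.
Proof. by move=> x y; elim: m => //= m ->; rewrite linearD. Qed.

Lemma iter_linearMn (K : fieldType) (X : lmodType K) (f : {linear X -> X}) m n x :
  iter m f (x *+ n) = iter m f x *+ n.
Proof. by elim: m => //= m ->; rewrite linearMn. Qed.

Section Locality.
Variables (K : numFieldType) (V : logVA K).

Local Notation Y := (stateField V).
Local Notation S := (tact (braiding V)).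
Local Notation T := (translation V).
Local Notation one := (vacuum V).

Lemma expS_mon0 N (x : V \tensor V) k :
  expS N x (mon N%:Z 0 k) = (k`!%:R : K)^-1 *: iter k S x.
Proof.
have [M SM] := braiding_nilpotent x.
rewrite /expS (fprodE (D := 0) (J := 1)); first last.
- move=> j l hj hl; rewrite (homdeg_out _ (@fpow_z12_homdeg K N)) ?scale0r //=.
  by apply/orP; left; lia.
- exact: fexp_homdeg SM.
- by move=> a; rewrite scaler0.
rewrite big_ord1 big_ord_recr /= big1 ?add0r => [|l _]; last first.
  have -> : cofactor (mon N%:Z 0 k) 0 0 l = mon N%:Z 0 (k - l) by apply: monom2_eq => //=; rewrite subr0.
  by rewrite fpow_z12_mon subn_eq0 leqNgt ltn_ord scale0r.
have -> : cofactor (mon N%:Z 0 k) 0 0 k = mon N%:Z 0 0 by apply: monom2_eq => //=; rewrite ?subr0 ?subnn.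
by rewrite fpow_z12_mon /= bin0 mul1r scale1r (fexp_mon0 SM).
Qed.

Lemma expS_ker N (x : V \tensor V) j k : S x = 0 ->
  expS N x (mon N%:Z j k) = (if k == 0%N then (-1) ^+ j * 'C(N, j)%:R else 0 : K) *: x.
Proof.
move=> Sx; have SM : iter 1 S x = 0 by [].
rewrite /expS (fprodE (D := 0) (J := 1)); first last.
- move=> i l hi hl; rewrite (fexpE SM) big_ord1 /=.
  by rewrite fone_mon gtn_eqF // mul0r scale0r scaler0.
- exact: fexp_homdeg SM.
- by move=> a; rewrite scaler0.
have c0 : cofactor (mon N%:Z j k) 0 0 0 = mon N%:Z j k.
  by apply: monom2_eq => //=; rewrite ?subr0 ?subn0.
rewrite big_ord1 big_ord_recl /= big1 ?addr0 => [|l _]; rewrite (fexp_mon0 SM).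
  by rewrite c0 fpow_z12_mon invr1 scale1r.
by rewrite /bump add1n (iter_linear_ge SM) // !scaler0.
Qed.

(* The left-hand side of locality, with x in place of a (x) b. *)
Definition Phi N (x : V \tensor V) (c : V) : monom2 -> V :=
  fprod (@app _ _ _) (YYc V c) (expS N x).

Lemma iter_op12 m (x : V \tensor V) (c : V) :
  iter m (op12 S) (x \ox c) = iter m S x \ox c.
Proof. by elim: m => //= m ->; rewrite tmap_even //; exact: hid_even. Qed.

Lemma expS_op12 N (x : V \tensor V) (c : V) e :
  fprod *:%R (fpow z12 N) (fexp theta12 (op12 S) (x \ox c)) e = expS N x e \ox c.
Proof.
have [M SM] := braiding_nilpotent x.
have SM12 : iter M (op12 S) (x \ox c) = 0 by rewrite iter_op12 SM bilin0.
have small j k : (`|e.2.1|.+1 <= j)%N -> (k <= e.1.2)%N ->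
    fpow z12 N (cofactor e 0 j k) = 0 :> K.
  move=> hj hk; rewrite (homdeg_out _ (@fpow_z12_homdeg K N)) //=.
  by apply/orP; left; lia.
rewrite /expS (fprodE (D := 0) (J := `|e.2.1|.+1)); first last.
- by move=> j k hj hk; rewrite small ?scale0r.
- exact: fexp_homdeg SM12.
- by move=> a; rewrite scaler0.
rewrite (fprodE (D := 0) (J := `|e.2.1|.+1)); first last.
- by move=> j k hj hk; rewrite small ?scale0r.
- exact: fexp_homdeg SM.
- by move=> a; rewrite scaler0.
rewrite bilin_sum; apply: eq_bigr => j _; rewrite bilin_sum; apply: eq_bigr => k _.
rewrite bilinZ; congr (_ *: _); rewrite (fexpE SM12) (fexpE SM) bilin_sum.
by apply: eq_bigr => m _; rewrite bilinZ iter_op12.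
Qed.

(** Since theta_21 is theta_12 with the variables exchanged and z_12 changes sign, the right-hand
    side of locality is the left-hand side for b (x) a with swapped variables, up to (-1)^N. One
    function [Phi] thus describes both sides. *)
Lemma Phi_locality p q (a b : V) : homog p a -> homog q b ->
  exists N, forall c e,
    Phi N (a \ox b) c e = (ksign p q * (-1) ^+ N : K) *: Phi N (b \ox a) c (swapm e).
Proof.
move=> ap bq; have [N loc] := locality ap bq; exists N => c e.
have {loc} := loc c e.
rewrite {1}/fprod; under eq_fsbigr do rewrite expS_op12.
rewrite -[LHS]/(Phi N (a \ox b) c e) => ->; rewrite -scalerA; congr (_ *: _).
have -> : fprod *:%R (fpow z12 N) (fexp theta21 (op12 S) (b \ox a \ox c)) =
    fun e' => ((-1) ^+ N : K) *: (expS N (b \ox a) (swapm e') \ox c).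
  apply/funext => e'; rewrite fexp_theta21 fpow_z12_swap.
  rewrite -expS_op12 -fprod_swap /fprod scaler_fsum ?signr_eq0 //.
  by apply: eq_fsbigr => d _; rewrite /= scalerA.
rewrite /Phi -fprod_swap /fprod scaler_fsum ?signr_eq0 //.
by apply: eq_fsbigr => d _; exact: (linearZ_LR (YY21 Y d.1)).
Qed.

Lemma Phi_out N x n k m l : (m < 0) || (0 < l)%N -> Phi N x one ((n, k), (m, l)) = 0.
Proof.
move=> h; rewrite /Phi (fprodE (D := N%:Z) (J := `|m|.+1)); first last.
- by move=> j i hj hi; rewrite /app YYc_vacuum_out //=; apply/orP; left; lia.
- exact: expS_homdeg.
- by move=> f; rewrite /app linear0.
rewrite big1 // => j _; rewrite big1 // => i _.
rewrite /app YYc_vacuum_out //=; case/orP: h => [m0|->]; last by rewrite orbT.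
by apply/orP; left; lia.
Qed.

Lemma Phi_row0 N x n k : Phi N x one ((n, k), (0, 0%N)) =
  \sum_(i < k.+1) (i`!%:R : K)^-1 *: Yc V (n - N%:Z) (k - i) (iter i S x).
Proof.
rewrite /Phi (fprodE (D := N%:Z) (J := 1)); first last.
- by move=> j i hj hi; rewrite /app YYc_vacuum_out //=; apply/orP; left; lia.
- exact: expS_homdeg.
- by move=> f; rewrite /app linear0.
rewrite big_ord1; apply: eq_bigr => i _.
rewrite /app expS_mon0 linearZ_LR; congr (_ *: _).
by rewrite /cofactor !subr0 YYc_vacuum0.
Qed.

(** By the Leibniz rule, [delta] acts only on the fields, as it kills [expS]; on the fields it is T
    by [delta_YYc_vacuum]. *)
Lemma translation_Phi N x e : T (Phi N x one e) = delta (Phi N x one) e.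
Proof.
have small (f : monom2 -> {linear V \tensor V -> V}) e' j k :
    (forall d, d.2.1 < 0 -> f d = 0) -> (`|e'.2.1|.+1 <= j)%N ->
    app (f (cofactor e' N%:Z j k)) (expS N x (mon N%:Z j k)) = 0.
  by move=> h hj; rewrite /app h //=; lia.
have out d : d.2.1 < 0 -> YYc V one d = 0.
  by case: d => [[n k] [m l]] /= m0; rewrite YYc_vacuum_out ?m0.
have app0 (f : {linear V \tensor V -> V}) : app f 0 = 0 by rewrite /app linear0.
rewrite /Phi delta_fprod //.
- rewrite [X in _ + X]fprod0l ?addr0 => [|d d']; last by rewrite delta_expS app0.
  rewrite (fprodE (D := N%:Z) (J := `|e.2.1|.+1)) //; last 2 first.
  + exact: expS_homdeg.
  + by move=> j k hj _; apply: small.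
  rewrite (fprodE (D := N%:Z) (J := `|e.2.1|.+1)) //; last 2 first.
  + exact: expS_homdeg.
  + move=> j k hj _; apply: small => // d d0; rewrite delta_YYc_vacuum out //.
    by apply: homP => y; rewrite /hcomp /= linear0.
  rewrite linear_sum; apply: eq_bigr => j _; rewrite linear_sum; apply: eq_bigr => k _.
  by rewrite delta_YYc_vacuum.
- by move=> f y z; rewrite /app linearD.
- move=> e'; apply: (@finite_fprod_supp _ _ _ _ (YYc V one) (expS N x) N%:Z `|e'.2.1|.+1) => //.
  + exact: expS_homdeg.
  + by move=> j k hj _; apply: small.
Qed.

(** This is the coefficient of zeta_1^k at z_2 = 0 in locality with c = 1. The right-hand side has
    no zeta_1: theta_21 does not contain it, and Y(a, z_1) applied to the vacuum is free of
    logarithms. *)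
Lemma Yc_expS_eq0 n k x : (0 < k)%N ->
  \sum_(i < k.+1) (i`!%:R : K)^-1 *: Yc V n (k - i) (iter i S x) = 0.
Proof.
move=> k0; elim/tensor_homog_ind: x => [|x y hx hy|p q a b ap bq].
- by rewrite big1 // => i _; rewrite iter_linear0 linear0 scaler0.
- have := congr2 +%R hx hy; rewrite addr0 => h; rewrite -[RHS]h -big_split.
  by apply: eq_bigr => i _; rewrite iter_linearD (linearD (Yc V n (k - i))) scalerDr.
have [N loc] := Phi_locality ap bq.
have := Phi_row0 N (a \ox b) (n + N%:Z) k; rewrite addrK => <-.
by rewrite loc Phi_out ?k0 ?orbT ?scaler0.
Qed.

(* Y(z) = Y(z)|_{zeta = 0} e^{- zeta S} *)
Lemma Yc_zeta n k x : Yc V n k x = ((-1) ^+ k / k`!%:R : K) *: Yc V n 0 (iter k S x).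
Proof.
elim/ltn_ind: k x => k ih x; case: k ih => [|k] ih.
  by rewrite expr0 mul1r invr1 scale1r.
have := Yc_expS_eq0 n x (ltn0Sn k); rewrite big_ord_recl /= invr1 scale1r subn0.
move/eqP; rewrite addr_eq0 => /eqP ->; rewrite -sumrN.
have fact0 i : (i`!%:R : K) != 0 by rewrite pnatr_eq0 -lt0n fact_gt0.
(* The expansion of (1 - 1)^(k+1) divided by (k+1)!, which inverts the exponential. *)
have binZ : \sum_(i < k.+2) ((-1) ^+ (k.+1 - i) / (i`!%:R * (k.+1 - i)`!%:R) : K) = 0.
  apply: (mulfI (fact0 k.+1)); rewrite mulr0 mulr_sumr.
  have := exprDn (-1 : K) 1 k.+1; rewrite addNr expr0n /= => E; rewrite [RHS]E.
  apply: eq_bigr => i _; rewrite expr1n mulr1 -[RHS]mulr_natr mulrCA; congr (_ * _).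
  rewrite -natrM -(bin_fact (m := i) (n := k.+1)) -1?ltnS // natrM mulfK //.
  by rewrite natrM mulf_neq0.
move: binZ; rewrite big_ord_recl subn0 mul1r => /eqP; rewrite addr_eq0 => /eqP ->.
rewrite -sumrN scaler_suml; apply: eq_bigr => i _.
have ik : (i <= k)%N by rewrite -ltnS.
have eS : iter (k - i) S (S (iter i S x)) = S (iter k S x).
  by rewrite -[S (iter i S x)]iterS -iterD addnS subnK.
rewrite /bump /= !add1n !subSS add0n ih ?ltnS ?leq_subr // eS scalerA -scaleNr.
by congr (- _ *: _); rewrite invfM; ring.
Qed.

Lemma Yc_braiding n k x : Yc V n k.+1 x *+ k.+1 = - Yc V n k (S x).
Proof.
rewrite [in LHS]Yc_zeta [in RHS]Yc_zeta -iterSr -scaler_nat scalerA -scaleNr.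
congr (_ *: _); rewrite factS natrM exprS.
have k0 : (k.+1%:R : K) != 0 by rewrite pnatr_eq0.
have f0 : (k`!%:R : K) != 0 by rewrite pnatr_eq0 -lt0n fact_gt0.
move: k0 f0; move: (k.+1%:R : K) (k`!%:R : K) => r s r0 s0.
by rewrite mulN1r !mulNr mulrN mulrCA invfM mulVKf.
Qed.

Lemma flip_braiding x : S (flip x) = flip (S x).
Proof.
have := braiding_flip (braiding_axioms V).
by move=> /(congr1 (fun f : {linear V \tensor V -> V \tensor V} => f x)).
Qed.

Lemma skew_sum_widen (F : int -> V) m R R' :
  (forall r, (R <= r)%N -> F (m - r%:Z) = 0) -> (R <= R')%N ->
  skew_sum T R' m F = skew_sum T R m F.
Proof.
move=> F0 RR'; rewrite /skew_sum -(subnKC RR') big_split_ord /= [X in _ + X]big1 ?addr0 //.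
by move=> r _; rewrite F0 ?leq_addr // linear0 scaler0.
Qed.

(** E collects the coefficients without zeta of the common value of locality with c = 1. Up to a
    shift by N, its row z_2^0 is Y(z)(a (x) b) and its column z_1^0 is the flipped product times
    (-1)^N; [translation_array] computes the column from the row. *)
Lemma skew_symmetry_homog p q (a b : V) m R : homog p a -> homog q b ->
  (forall r, (R <= r)%N -> Yc V (m - r%:Z) 0 (a \ox b) = 0) ->
  Yc V m 0 (flip (a \ox b)) = skew_sum T R m (fun n => Yc V n 0 (a \ox b)).
Proof.
move=> ap bq F0; have [N loc] := Phi_locality ap bq.
pose E n l := Phi N (a \ox b) one ((n, 0%N), (l, 0%N)).
have E0 n : E n 0 = Yc V (n - N%:Z) 0 (a \ox b).
  by rewrite /E Phi_row0 big_ord1 invr1 scale1r.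
have Eneg n l : n < 0 -> E n l = 0 by move=> n0; rewrite /E loc Phi_out ?n0 ?scaler0.
have EC l : E 0 l = (-1) ^+ N *: Yc V (l - N%:Z) 0 (flip (a \ox b)).
  rewrite /E loc /swapm Phi_row0 big_ord1 invr1 scale1r (flip_homogE ap bq) linearZ /=.
  by rewrite scalerA mulrC.
have TE n l : T (E n l) = E (n + 1) l *~ (n + 1) + E n (l + 1) *~ (l + 1).
  rewrite /E translation_Phi deltaE.
  have -> : Phi N (a \ox b) one ((n + 1, 1%N), (l, 0%N)) = 0.
    by rewrite loc Phi_out ?orbT // scaler0.
  by rewrite [Phi N _ one (_, (_, 1%N))]Phi_out ?orbT // !mul0rn !addr0.
have {}EC l : Yc V (l - N%:Z) 0 (flip (a \ox b)) = (-1) ^+ N *: E 0 l.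
  by rewrite EC scalerA -expr2 sqrr_sign scale1r.
(* The factor z_12^N moves the exponent m to m + N; if that is negative, both sides vanish. *)
rewrite -(addrK N%:Z m) EC addrK; case: (ltP (m + N%:Z) 0) => [mN|].
  rewrite /E Phi_out ?mN // scaler0 /skew_sum big1 // => r _.
  by rewrite -(addrK N%:Z (m - _)) -E0 Eneg ?linear0 ?scaler0 //; lia.
case emN : (m + N%:Z) => [M|//] _.
have F0' r : (M.+1 <= r)%N -> Yc V (m - r%:Z) 0 (a \ox b) = 0.
  by move=> hr; rewrite -(addrK N%:Z (m - _)) -E0 Eneg //; lia.
rewrite -(skew_sum_widen F0 (leq_maxl R M.+1)) (skew_sum_widen F0' (leq_maxr R M.+1)).
rewrite -[E 0 M]/(E 0%N M) (translation_array TE) /skew_sum scaler_sumr.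
apply: eq_bigr => r _; rewrite add0n bin0 mulr1 add0r -scaler_int scalerA E0.
have -> : M%:Z - r%:Z - N%:Z = m - r%:Z by rewrite -emN; ring.
congr (_ *: _); rewrite rmorphXn /= rmorphN1.
have -> : m = M%:Z - N%:Z by rewrite -emN addrK.
have -> : M%:Z - N%:Z - r%:Z = (M - r)%N%:Z - N%:Z by rewrite -subzn ?leq_ord //; ring.
by rewrite expfzDr ?oppr_eq0 ?oner_eq0 // -exprz_inv invrN1 mulrC.
Qed.

Lemma skew_symmetry k x m R : (forall r, (R <= r)%N -> Yc V (m - r%:Z) k x = 0) ->
  Yc V m k (flip x) = skew_sum T R m (fun n => Yc V n k x).
Proof.
(* The assumption on R concerns x, not the homogeneous tensors of which x is a sum; hence an
   identity for all large R first, cut back later by [skew_sum_widen]. *)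
have key y : exists R0, forall R, (R0 <= R)%N ->
    Yc V m 0 (flip y) = skew_sum T R m (fun n => Yc V n 0 y).
  elim/tensor_homog_ind: y => [|y z [R0 hy] [R1 hz]|p q a b ap bq].
  - exists 0%N => R' _; rewrite !linear0 /skew_sum big1 // => r _.
    by rewrite !linear0.
  - exists (maxn R0 R1) => R'; rewrite geq_max => /andP[h0 h1].
    rewrite !linearD (hy _ h0) (hz _ h1) /skew_sum -big_split; apply: eq_bigr => r _.
    by rewrite !linearD.
  - have [B hB] := Yc_lower_bound 0 (a \ox b); exists `|m - B|.+1%N => R' hR.
    by apply: (skew_symmetry_homog ap bq) => r hr; apply: hB; lia.
move=> F0; have [R0 hR] := key (iter k S x).
have c0 : ((-1) ^+ k / k`!%:R : K) != 0.
  by rewrite mulf_neq0 ?signr_eq0 // invr_eq0 pnatr_eq0 -lt0n fact_gt0.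
rewrite -(skew_sum_widen F0 (leq_maxl R R0)) Yc_zeta.
have -> : iter k S (flip x) = flip (iter k S x).
  by elim: k {F0 hR c0} => //= k ->; rewrite flip_braiding.
rewrite (hR _ (leq_maxr R R0)) /skew_sum scaler_sumr; apply: eq_bigr => r _.
rewrite [in RHS]Yc_zeta (linearZ_LR (divpow T r)).
by rewrite scalerA [RHS]scalerA; congr (_ *: _); exact: mulrC.
Qed.

End Locality.

(** * The Virasoro operators *)

Section Conformal.
Variables (K : numFieldType) (V : logVA K) (omega : V) (c : K).
Hypothesis hconf : is_conformal V omega c.

Local Notation Y := (stateField V).
Local Notation S := (tact (braiding V)).
Local Notation T := (translation V).
Local Notation L := (Vir V omega).

Lemma VirE n v : L n v = Yc V (- (n + 1) - 1) 0 (omega \ox v).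
Proof. by rewrite YcE. Qed.

Lemma Vir_homog n p v : homog p v -> homog p (L n v).
Proof.
move=> pv; rewrite VirE -Ycoef_Yc.
by apply: even_homog; [exact: Ycoef_even|exact: (tensor_homog (omega_even hconf) pv)].
Qed.

Lemma Vir_even n : homog false (L n).
Proof.
apply: homP => u; rewrite par_homE -[in RHS](par_bigsum u) linear_sum.
by apply: eq_bigr => q _; apply: Vir_homog (par_homog q u).
Qed.

Lemma Vir_translation_comm n v : L n (T v) = T (L n v) + L (n - 1) v *~ (n + 1).
Proof.
have : L n (L (-1) v) - L (-1) (L n v) = (n - -1)%:~R *: L (n - 1) v +
    (if n - 1 == 0 then (n ^+ 3 - n)%:~R / 12%:R * c else 0) *: v.
  exact: (congr1 (fun f : {linear V -> V} => f v) (Vir_rel hconf n (-1))).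
rewrite (Vir_translation hconf) opprK scaler_int => /eqP; rewrite subr_eq => /eqP ->.
rewrite [if _ then _ else _](_ : _ = 0) ?scale0r ?addr0; first exact: addrC.
(* The central term could occur only for n = 1, where n^3 - n = 0. *)
case: eqP => // /eqP; rewrite subr_eq0 => /eqP ->.
by rewrite expr1n subrr mul0r mul0r.
Qed.

Lemma Vir_lower v : exists N, forall j : nat, (N <= j)%N -> L (j%:Z - 1) v = 0.
Proof.
have [B hB] := Yc_lower_bound 0 (omega \ox v).
by exists `|B|%N.+1 => j hj; rewrite VirE hB //; lia.
Qed.

Lemma omega_braiding_r p v : homog p v -> S (v \ox omega) = 0.
Proof.
move=> pv; have := flip_braiding (omega \ox v).
rewrite (omega_S hconf) linear0 (flip_homogE (omega_even hconf) pv).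
by rewrite /ksign expr0 scale1r.
Qed.

Lemma Phi_omega_l N (a b : V) n1 n2 k :
  Phi N (omega \ox a) b ((n1, 0%N), (n2, k)) =
  \sum_(l < N.+1) ((-1) ^+ l * 'C(N, l)%:R : K) *:
    Yc V (n1 - (N%:Z - l%:Z)) 0 (omega \ox Yc V (n2 - l%:Z) k (a \ox b)).
Proof.
have Sx := omega_S hconf a.
rewrite /Phi (fprodE (D := N%:Z) (J := N.+1)); first last.
- move=> j i hj hi; rewrite (expS_ker _ _ _ Sx) bin_small // mulr0 if_same scale0r.
  by rewrite /app linear0.
- exact: expS_homdeg.
- by move=> f; rewrite /app linear0.
apply: eq_bigr => l _; rewrite big_ord1 (expS_ker _ _ _ Sx) eqxx.
by rewrite /app linearZ_LR; congr (_ *: _); rewrite /cofactor YYcE.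
Qed.

Lemma Phi_omega_r N p (a b : V) n1 n2 k : homog p a ->
  Phi N (a \ox omega) b ((n2, k), (n1, 0%N)) =
  \sum_(l < N.+1) ((-1) ^+ l * 'C(N, l)%:R : K) *:
    Yc V (n2 - (N%:Z - l%:Z)) k (a \ox Yc V (n1 - l%:Z) 0 (omega \ox b)).
Proof.
move=> pa; have Sx := omega_braiding_r pa.
rewrite /Phi (fprodE (D := N%:Z) (J := N.+1)); first last.
- move=> j i hj hi; rewrite (expS_ker _ _ _ Sx) bin_small // mulr0 if_same scale0r.
  by rewrite /app linear0.
- exact: expS_homdeg.
- by move=> f; rewrite /app linear0.
apply: eq_bigr => l _; rewrite big_ord_recl big1 ?addr0 => [|i _].
  rewrite (expS_ker _ _ _ Sx) eqxx /app linearZ_LR; congr (_ *: _).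
  by rewrite /cofactor YYcE subn0.
suff -> : expS N (a \ox omega) (mon N%:Z l (lift ord0 i)) = 0 by rewrite /app linear0.
by rewrite (expS_ker _ _ _ Sx) /= scale0r.
Qed.

(** S kills omega (x) a and a (x) omega, so both exponentials are trivial and only the binomial
    expansions of z_12^N remain. The bound N depends on a alone. *)
Lemma omega_locality p (a : V) : homog p a -> exists N, forall k b s n,
  bdiff (fun i n => L i (Yc V n k (a \ox b)) - Yc V n k (a \ox L i b)) N s n = 0.
Proof.
move=> pa; have [N loc] := Phi_locality (omega_even hconf) pa.
(* L_i is the coefficient of w^(-i-2) in Y(omega, w), while [bdiff] places B i at w^(-i-1); hence
   the exponent - s - 1. *)
exists N => k b s n; have := loc b ((- s - 1, 0%N), (n, k)).
rewrite /swapm Phi_omega_l (Phi_omega_r _ _ _ _ _ pa) /ksign expr0 mul1r scaler_sumr.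
rewrite [in RHS](reindex_inj rev_ord_inj) /= => /eqP; rewrite -subr_eq0 -sumrB => /eqP h.
rewrite -[RHS]h /bdiff; apply: eq_bigr => l _.
have lN : (l <= N)%N by rewrite -ltnS.
rewrite subSS bin_sub // scalerA mulrA -exprD -subzn //.
(* The sign (-1)^N of the exchange meets the (-1)^(N-l) of the reversed binomial sum. *)
have -> : (-1) ^+ (N + (N - l)) = (-1) ^+ l :> K.
  by rewrite -signr_odd oddD oddB // addbA addbb /= signr_odd.
rewrite -scaler_int scalerBr intrM rmorphXn /= rmorphN1 -!YcE.
have -> : - (N%:Z - l%:Z - 1 + s + 1) - 1 = - s - 1 - (N%:Z - l%:Z) by ring.
by have -> : n - (N%:Z - (N%:Z - l%:Z)) = n - l%:Z by ring.
Qed.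

Lemma Vir_Yc_commutator n k (a b : V) :
  L 0 (Yc V n k (a \ox b)) - Yc V n k (a \ox L 0 b) - Yc V n k (L 0 a \ox b) =
  Yc V n k (a \ox b) *~ n + Yc V n k.+1 (a \ox b) *+ k.+1.
Proof.
pose D (a b : V) := Yc V n k (a \ox b) *~ n + Yc V n k.+1 (a \ox b) *+ k.+1.
suff hom p q (u w : V) : homog p u -> homog q w -> 
  L 0 (Yc V n k (u \ox w)) - Yc V n k (u \ox L 0 w) - Yc V n k (L 0 u \ox w) = D u w.
  pose F : {linear V \tensor V -> V} := hcomp (L 0) (Yc V n k)
    - hcomp (Yc V n k) (tmap hid (L 0)) - hcomp (Yc V n k) (tmap (L 0) hid).
  pose G : {linear V \tensor V -> V} := Yc V n k *~ n + Yc V n k.+1 *+ k.+1.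
  have FE u w : F (u \ox w) =
      L 0 (Yc V n k (u \ox w)) - Yc V n k (u \ox L 0 w) - Yc V n k (L 0 u \ox w).
    rewrite /F !(homDE, homNE) -!/(app _ _) /hcomp /app /= !tmap_even //.
      exact: hid_even.
    exact: Vir_even.
  have GE u w : G (u \ox w) = D u w by rewrite /G /D !pmulrn homDE !hom_mulrz.
  rewrite -FE -[RHS]GE; congr (app _ _); apply: tensor_homog_ext => p q u w pu qw.
  by rewrite FE GE; apply: hom pu qw.
move=> pu qw.
(* Covariance read at z^(n-1): D is the coefficient of z^n in z [T, Y(u, z)] w. *)
have -> : D u w = L (-1) (Yc V (n - 1) k (u \ox w)) - Yc V (n - 1) k (u \ox L (-1) w).
  by rewrite (Vir_translation hconf) translation_Yc subrK addrC addKr.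
apply: (@commutator_from_locality _ _ L (fun n a b => Yc V n k (a \ox b))).
- by have [N hN] := omega_locality pu; exists N => s m; apply: hN.
(* Locality is now used for omega and w, acting on u, and transported to Y(u, z) w by the flip; the
   sign of the flip is the same on both sides and cancels. *)
- have [N hN] := omega_locality qw; exists N => j m Nj.
  have ks : (ksign q p : K) != 0 by rewrite /ksign signr_eq0.
  have := @skew_locality _ _ T L Vir_translation_comm
    (fun n => Yc V n k (w \ox u)) (fun n => Yc V n k (flip (w \ox u)))
    (fun i n => Yc V n k (w \ox L i u)) (fun i n => Yc V n k (flip (w \ox L i u))) j.
  move=> /(_ (Yc_lower_bound _ _) (fun i => Yc_lower_bound _ _)).
  move=> /(_ (fun m R => @skew_symmetry _ _ _ _ m R) (fun i m R => @skew_symmetry _ _ _ _ m R)).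
  move=> sk; apply: (scalerI ks).
  have {}sk : L (j%:Z - 1) (Yc V m k (flip (w \ox u))) = \sum_(l < j.+1)
      Yc V (m - l%:Z) k (flip (w \ox L (j%:Z - l%:Z - 1) u)) *+ 'C(j, l).
    apply: sk => n'; have := bdiff_vanish (hN k u) 0 n' Nj.
    by rewrite /bdiff; under eq_bigr do rewrite addr0.
  move: sk; rewrite (flip_homogE qw pu) !linearZ_LR scaler_sumr => ->.
  apply: eq_bigr => l _; rewrite (flip_homogE qw (Vir_homog _ pu)) linearZ_LR.
  by rewrite scalerMnr.
- have [N1 h1] := Vir_lower u; have [N2 h2] := Vir_lower w.
  exists (maxn N1 N2) => j; rewrite geq_max => /andP[j1 j2].
  by rewrite h1 // h2.
- by move=> m; rewrite !linear0.
- by move=> m; rewrite bilin0 linear0.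
Qed.

End Conformal.

(** * Jordan decomposition of L_0 *)

Section Jordan.
Variables (K : fieldType) (V : lmodType K).

Lemma iter_comm (C N : V -> V) m y : (forall z, C (N z) = N (C z)) ->
  iter m C (N y) = N (iter m C y).
Proof. by move=> CN; elim: m => //= m ->. Qed.

Lemma iter_eq0_le (C : {linear V -> V}) e e' y : (e <= e')%N ->
  iter e C y = 0 -> iter e' C y = 0.
Proof. by move=> /subnK <- h; rewrite iterD h iter_linear0. Qed.

(** In D y = C y - N y each term lowers one of the two nilpotency orders and, by commutation, keeps
    the other. *)
Lemma iter_commuting_sub (C N D : {linear V -> V}) e f y :
  (forall z, C (N z) = N (C z)) -> (forall z, D z = C z - N z) ->
  iter e C y = 0 -> iter f N y = 0 -> iter (e + f) D y = 0.
Proof.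
move=> CN DE; have [m] := ubnP (e + f); elim: m e f y => // m ih [|e] [|f] y.
- by move=> _ /= ->.
- by move=> _ y0 _; rewrite (y0 : y = 0) iter_linear0.
- by move=> _ _ y0; rewrite (y0 : y = 0) iter_linear0.
rewrite ltnS => efm Cy Ny.
rewrite addSn iterSr DE iter_linearD -scaleN1r.
have DN z : iter (e + f.+1) D (- z) = - iter (e + f.+1) D z.
  by elim: (e + f.+1)%N => //= i ->; rewrite linearN.
rewrite scaleN1r DN (ih e f.+1 (C y)); first last.
- by rewrite iter_comm ?Ny ?linear0.
- by rewrite -iterSr.
- by [].
rewrite addnS -addSn (ih e.+1 f (N y)) ?subr0 //.
- by rewrite addSn -addnS.
- by rewrite iter_comm ?Cy ?linear0.
- by rewrite -iterSr.
Qed.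

(** The eigenvalues l i may repeat, so polynomials replace a grouping by eigenspaces. R has the
    nonzero l i as roots and is coprime to X^e; from q X^e + r R = 1 it follows that q X X^e takes
    the value l i at every l i. Hence B y is a polynomial in B applied to B^e y. *)
Lemma semisimple_kernel (B : {linear V -> V}) e y : semisimple B ->
  iter e B y = 0 -> B y = 0.
Proof.
move=> /(_ y) [n [u [l [-> Bu]]]] Be.
have iterB j : iter j B (\sum_i u i) = \sum_i l i ^+ j *: u i.
  elim: j => [|j ih] /=; first by apply: eq_bigr => i _; rewrite expr0 scale1r.
  by rewrite ih linear_sum; apply: eq_bigr => i _; rewrite linearZ /= Bu scalerA exprSr.
pose R := \prod_(i | l i != 0) ('X - (l i)%:P).
have : coprimep ('X^e : {poly K}) R.
  apply: (big_ind (fun q => coprimep 'X^e q)); first exact: coprimep1.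
    by move=> p q hp hq; rewrite coprimepMr hp.
  by move=> i li; apply: coprimep_expl; rewrite coprimep_XsubC rootE hornerX.
move=> /Bezout_eq1_coprimepP [[q r] /= qr].
have qE i : (q * 'X).[l i] * l i ^+ e = l i.
  have := congr1 (fun p => (p * 'X).[l i]) qr.
  rewrite mul1r mulrDl hornerD !hornerM hornerXn hornerX => E.
  have [l0|li] := eqVneq (l i) 0; first by rewrite l0 mulr0 mul0r.
  rewrite -[RHS]E.
  have -> : R.[l i] = 0 by rewrite /R horner_prod (bigD1 i) //= !hornerE subrr mul0r.
  by rewrite mulr0 mul0r addr0 mulrAC.
have -> : B (\sum_i u i) = \sum_i ((q * 'X).[l i] * l i ^+ e) *: u i.
  by rewrite linear_sum; apply: eq_bigr => i _; rewrite qE Bu.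
under eq_bigr => i _ do rewrite horner_coef mulr_suml scaler_suml.
rewrite exchange_big big1 //= => k _.
under eq_bigr => i _ do rewrite -mulrA -exprD -scalerA.
rewrite -scaler_sumr -iterB addnC.
by rewrite (iter_eq0_le _ Be) ?scaler0 ?leq_addr.
Qed.

Variables A As An : {linear V -> V}.
Hypothesis JC : Jordan_Chevalley A As An.

Lemma JC_sum v : A v = As v + An v.
Proof. by have [-> _ _ _] := JC. Qed.

Lemma JC_comm v : As (An v) = An (As v).
Proof.
have [_ h _ _] := JC; apply/eqP; rewrite -subr_eq0; apply/eqP.
exact: (congr1 (fun f : {linear V -> V} => f v) h).
Qed.

Definition shiftop (B : {linear V -> V}) (a : K) : {linear V -> V} := B - a *: hid.

Lemma shiftopE B a v : shiftop B a v = B v - a *: v.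
Proof. by []. Qed.

(** As - a = (A - a) - An is a difference of commuting operators that are nilpotent at y, hence
    nilpotent at y; being semisimple, it kills y. *)
Lemma JC_eigen a e y : iter e (shiftop A a) y = 0 -> As y = a *: y.
Proof.
have [_ _ ss nil] := JC; move=> Cy; have [f Ny] := nil y.
apply/eqP; rewrite -subr_eq0; apply/eqP; rewrite -shiftopE.
apply: (@semisimple_kernel _ (e + f)).
  move=> v; have [n [u [l [-> Bu]]]] := ss v.
  exists n, u, (fun i => l i - a); split=> // i.
  by rewrite shiftopE Bu scalerBl.
apply: (iter_commuting_sub _ _ Cy Ny) => z; rewrite !shiftopE.
  by rewrite (linearB An) (linearZ_LR An) !JC_sum JC_comm (linearD An).
by rewrite JC_sum [RHS]addrAC addrK.
Qed.

End Jordan.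

Section NilpotentPart.
Variables (K : numFieldType) (V : logVA K) (omega : V) (c : K).
Hypothesis hconf : is_conformal V omega c.
Variables L0s L0n : {linear V -> V}.
Hypothesis JC : Jordan_Chevalley (Vir V omega 0) L0s L0n.

Local Notation S := (tact (braiding V)).
Local Notation L0 := (Vir V omega 0).

(** In the commutator formula the scalars a, b and the n of z d/dz merge into the shift. What
    remains either applies [L0n] to an argument or raises the power of zeta. *)
Let YcL0 n k u v a b : L0s u = a *: u -> L0s v = b *: v ->
  shiftop L0 (a + b + n%:~R) (Yc V n k (u \ox v)) =
  Yc V n k (L0n u \ox v) + Yc V n k (u \ox L0n v) + Yc V n k.+1 (u \ox v) *+ k.+1.
Proof.
move=> ua vb; have /eqP := Vir_Yc_commutator hconf n k u v.
rewrite !subr_eq !(JC_sum JC u, JC_sum JC v) ua vb bilinD (linearD (tpure V V u)) !linearD.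
rewrite bilinZ (linearZ_LR (tpure V V u)) !linearZ_LR shiftopE => /eqP ->.
rewrite !scalerDl scaler_int.
set X1 := a *: _; set X2 := b *: _; set X3 := _ *~ n.
by rewrite (AC ((2*2)*2) ((4*6*2)*(3*5*1))) /= addrK.
Qed.

Let shiftop_add a (x y : V) e f : iter e (shiftop L0 a) x = 0 ->
  iter f (shiftop L0 a) y = 0 -> iter (maxn e f) (shiftop L0 a) (x + y) = 0.
Proof.
move=> ex fy; rewrite iter_linearD (iter_eq0_le (leq_maxl e f) ex).
by rewrite (iter_eq0_le (leq_maxr e f) fy) addr0.
Qed.

(** Each application of the shifted L_0 lowers r or s, or raises k. The induction is on r + s and,
    inside it, on d - k, where d bounds the zeta-degree of Y(z)(u (x) v). *)
Let YcL0_nilpotent n a b m : forall r s u v k, (r + s < m)%N ->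
  L0s u = a *: u -> L0s v = b *: v -> iter r L0n u = 0 -> iter s L0n v = 0 ->
  exists e, iter e (shiftop L0 (a + b + n%:~R)) (Yc V n k (u \ox v)) = 0.
Proof.
elim: m => // m ih [|r] [|s] u v k.
- by move=> _ _ _ u0; exists 0%N; rewrite (u0 : u = 0) bilin0 linear0.
- by move=> _ _ _ u0; exists 0%N; rewrite (u0 : u = 0) bilin0 linear0.
- by move=> _ _ _ _ v0; exists 0%N; rewrite (v0 : v = 0) !linear0.
rewrite ltnS => rsm ua vb ur vs.
have [B [d hd]] := coef_bounded (tlift (stateField V) (u \ox v)).
have [t] := ubnP (d - k)%N; elim: t k => // t iht k; rewrite ltnS => dkt.
have [dk|kd] := leqP d k.
  by exists 0%N; rewrite -Ycoef_Yc /= hd // dk orbT.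
have comm' w l : L0s w = l *: w -> L0s (L0n w) = l *: L0n w.
  by move=> wl; rewrite (JC_comm JC) wl linearZ.
have [e1 h1] := ih r s.+1 (L0n u) v k rsm (comm' _ _ ua) vb (etrans (esym (iterSr _ _ _)) ur) vs.
have [|e2 h2] := ih r.+1 s u (L0n v) k _ ua (comm' _ _ vb) ur (etrans (esym (iterSr _ _ _)) vs).
  by rewrite addSnnS.
have [|e3 h3] := iht k.+1; first by rewrite (leq_trans _ dkt) // subnS prednK ?subn_gt0.
exists (maxn (maxn e1 e2) e3).+1; rewrite iterSr (YcL0 _ _ ua vb).
apply: shiftop_add; first exact: shiftop_add.
by rewrite iter_linearMn h3 mul0rn.
Qed.

(* On eigenvectors of L0s with eigenvalues a and b, the mode Yc n k takes values
   in the eigenspace for a + b + n, so L0n acts there as L0 - (a + b + n). *)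
Lemma nilpotent_part_Yc n k u v : L0n (Yc V n k (u \ox v)) =
  Yc V n k (L0n u \ox v) + Yc V n k (u \ox L0n v) - Yc V n k (S (u \ox v)).
Proof.
have [_ _ ss nil] := JC; rewrite -Yc_braiding.
pose P u v := L0n (Yc V n k (u \ox v)) =
  Yc V n k (L0n u \ox v) + Yc V n k (u \ox L0n v) + Yc V n k.+1 (u \ox v) *+ k.+1.
have P_eigen a b x y : L0s x = a *: x -> L0s y = b *: y -> P x y.
  move=> xa yb; have [r xr] := nil x; have [s ys] := nil y.
  have [e he] := @YcL0_nilpotent n a b (r + s).+1 r s x y k (ltnSn _) xa yb xr ys.
  rewrite /P -(YcL0 n k xa yb) shiftopE -(JC_eigen JC he) (JC_sum JC).
  by rewrite addrAC subrr add0r.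
have P0r x : P x 0 by rewrite /P !linear0 mul0rn !addr0.
have P0l y : P 0 y by rewrite /P !(linear0, bilin0) mul0rn !addr0.
have PDr x y z : P x y -> P x z -> P x (y + z).
  rewrite /P !(linearD (tpure V V _)) !linearD mulrnDl => -> ->.
  by rewrite addrACA [X in X + _ = _]addrACA.
have PDl x y z : P x z -> P y z -> P (x + y) z.
  rewrite /P !(bilinD (tpure V V)) !linearD mulrnDl => -> ->.
  by rewrite addrACA [X in X + _ = _]addrACA.
have [m [u' [a [-> ua]]]] := ss u; have [m' [v' [b [-> vb]]]] := ss v.
apply: (big_ind (fun x => P x _)) => // [x y|i _]; first exact: PDl.
apply: (big_ind (P _)) => // [x y|j _]; first exact: PDr.
exact: P_eigen (ua i) (vb j).
Qed.

End NilpotentPart.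

(** * Defect of the Leibniz rule for a product of two derivations *)

Section Derivations.
Variables (K : numFieldType) (V : logVA K).

Lemma derivation_Yc (D : {linear V -> V}) r q n k (a b : V) :
  is_derivation V D -> homog r D -> homog q a ->
  D (Yc V n k (a \ox b)) =
    Yc V n k (D a \ox b) + ksign q r *: Yc V n k (a \ox D b).
Proof.
move=> hD rD qa; have := congr1 (fun s => coef s n k) (hD a b).
rewrite (bigD1 q) //= (bigD1 r) //= rD qa [\sum_(_ | _ != r) _]big1 ?addr0; last first.
  by move=> r' /negbTE nr; rewrite -rD parK nr hom0E linear0 scaler0.
rewrite [\sum_(_ | _ != q) _]big1 ?addr0; last first.
  move=> q' /negbTE nq; rewrite big1 // => r' _.
  by rewrite -qa parK nq linear0 hom0E scaler0.
by rewrite !YcE.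
Qed.

(** As f and g have the same parity r, the two signs on the term with f (g b) cancel. The mixed
    terms carry (-1)^{qr} for f a (x) g b and (-1)^{(q+r)r} = (-1)^r (-1)^{qr} for g a (x) f b,
    which are the signs of the two tensor maps. *)
Lemma derivation_comp_Yc (f g : {linear V -> V}) r q n k (a b : V) :
  is_derivation V f -> is_derivation V g -> homog r f -> homog r g -> homog q a ->
  f (g (Yc V n k (a \ox b))) =
    Yc V n k (f (g a) \ox b) + Yc V n k (a \ox f (g b))
    + Yc V n k ((tmap f g + (-1) ^+ r *: tmap g f) (a \ox b)).
Proof.
move=> hf hg rf rg qa.
have qga : homog (r (+) q) (g a) := hom_homog rg qa.
rewrite (derivation_Yc _ _ _ hg rg qa) linearD linearZ_LR.
rewrite (derivation_Yc _ _ _ hf rf qga) (derivation_Yc _ _ _ hf rf qa).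
have -> : (tmap f g + (-1) ^+ r *: tmap g f) (a \ox b) =
    tmap f g (a \ox b) + (-1) ^+ r *: tmap g f (a \ox b) by [].
rewrite (tmap_homogE _ _ qa rg) (tmap_homogE _ _ qa rf).
rewrite (linearD (Yc V n k)) !(linearZ_LR (Yc V n k)) scalerDr !scalerA ksignK scale1r [RHS]addrAC.
rewrite -!addrA; congr (_ + _); rewrite addrCA; congr (_ *: _ + (_ *: _ + _)).
- by rewrite /ksign; case: (r); case: (q); rewrite //= ?mulr1 ?mulN1r ?opprK.
- by rewrite /ksign andbC.
Qed.

End Derivations.

Theorem proposition3p19 (R : realType) (V : logVA (complex R))
  (c : complex R) (omega : V) (hconf : is_conformal V omega c)
  (L0s L0n : {linear V -> V})
  (hJC : Jordan_Chevalley (Vir V omega 0) L0s L0n)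
  (L : nat) (d : {linear V -> V}) (f g : 'I_L -> {linear V -> V})
  (p : 'I_L -> bool)
  (hd : is_derivation V d) (hf : forall i, is_derivation V (f i))
  (hg : forall i, is_derivation V (g i))
  (pd : homog false d) (pf : forall i, homog (p i) (f i))
  (pg : forall i, homog (p i) (g i))
  (hL0n : L0n = d + \sum_(i < L) hcomp (f i) (g i))
  (a b : V) :
  eq_mod_kerY V (tact (braiding V) (a \ox b))
    (- (\sum_(i < L) (tmap (f i) (g i) + (-1) ^+ (p i) *: tmap (g i) (f i)))
       (a \ox b)).
Proof.
pose x := a \ox b.
pose E : {linear V \tensor V -> V \tensor V} :=
  \sum_(i < L) (tmap (f i) (g i) + (-1) ^+ (p i) *: tmap (g i) (f i)).
suff Yc_eq n k : hcomp (Yc V n k) (tact (braiding V)) = - hcomp (Yc V n k) E.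
  apply: logserP => n k.
  rewrite -/E -[coef _ n k]/(Ycoef (stateField V) (n, k) (tact (braiding V) x - - E x)).
  rewrite opprK Ycoef_Yc (linearD (Yc V n k)).
  have -> : Yc V n k (tact (braiding V) x) = - Yc V n k (E x).
    exact: (congr1 (fun u : {linear V \tensor V -> V} => u x) (Yc_eq n k)).
  by rewrite addNr.
apply: tensor_homog_ext => q r u v qu _.
rewrite -[LHS]/(Yc V n k (tact (braiding V) (u \ox v))) -[RHS]/(- Yc V n k (E (u \ox v))).
have := nilpotent_part_Yc hconf hJC n k u v.
have L0nE w : L0n w = d w + \sum_(i < L) f i (g i w).
  by rewrite hL0n homDE hom_sumE.
rewrite !L0nE (derivation_Yc _ _ _ hd pd qu).
under eq_bigr => i _ do
  rewrite (derivation_comp_Yc _ _ _ (hf i) (hg i) (pf i) (pg i) qu).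
rewrite !big_split /= bilinD (linearD (tpure V V u)) !(linearD (Yc V n k)).
rewrite bilin_sum (linear_sum (tpure V V u)) !(linear_sum (Yc V n k)).
rewrite /E hom_sumE linear_sum /= /ksign andbF scale1r addrA [X in X + _ = _]addrACA.
(* Both expressions for L_0^(n) Y(z)(u (x) v) contain the terms where L_0^(n) acts on u or on v;
   after cancellation the mixed terms equal - Y(z) S(u (x) v). *)
by move=> /addrI ->; rewrite opprK.
Qed.
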